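(* Let $w\colon \mathbb{N}\times\mathbb{N}\to\mathbb{R}$ be a nonnegative function satisfying $\sup_{k\ge 0}\sum_{j=0}^{\infty}w(j,k)<\infty$. Then $S_w$ is bounded if and only if $$\sup_{\sigma\in\Gamma}\vartheta_w(\sigma)<\infty .$$ In that case, it holds true that $$\|S_w\|=\sup_{\sigma\in\Gamma}\vartheta_w(\sigma)$$ and $\mathrm{Dom}\,S_w=\mathsf{L}^2(Z)$.
   Context: $\mathbb{N}$ is the set of nonnegative integers and $\Gamma$ the set of all finite subsets of $\mathbb{N}$; $\mathbf{1}_\sigma$ is the indicator function of $\sigma\in\Gamma$. $(\Omega,\mathscr{F},\mathbb{P})$ is a probability space and $Z=(Z_n)_{n\ge0}$ an independent sequence of random variables with $\mathbb{P}\{Z_n=\theta_n\}=p_n$, $\mathbb{P}\{Z_n=-1/\theta_n\}=q_n$, where $0<p_n<1$, $q_n=1-p_n$, $\theta_n=\sqrt{q_n/p_n}$, and $\mathscr{F}$ is the $\sigma$-field generated by $Z$. $\mathsf{L}^2(Z)=L^2(\Omega,\mathscr{F},\mathbb{P})$ (complex-valued), with inner product $\langle\xi,\eta\rangle=\mathbb{E}[\overline{\xi}\eta]$. Put $Z_\emptyset=1$ and $Z_\sigma=\prod_{i\in\sigma}Z_i$; $\{Z_\sigma\mid\sigma\in\Gamma\}$ is an orthonormal basis of $\mathsf{L}^2(Z)$ (the canonical ONB). For $k\in\mathbb{N}$, $\partial_k$ is the bounded operator on $\mathsf{L}^2(Z)$ with $\partial_kZ_\sigma=\mathbf{1}_\sigma(k)Z_{\sigma\setminus\{k\}}$,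 and its adjoint satisfies $\partial_k^*Z_\sigma=[1-\mathbf{1}_\sigma(k)]Z_{\sigma\cup\{k\}}$, for all $\sigma\in\Gamma$. A double series $\sum_{j,k=0}^\infty\xi_{jk}$ in $\mathsf{L}^2(Z)$ converges naturally if $s_n=\sum_{j=0}^n\sum_{k=0}^n\xi_{jk}$ converges in $\mathsf{L}^2(Z)$ as $n\to\infty$; its sum is then $\lim_n s_n$. For nonnegative $w$ with $\sup_{k\ge0}\sum_{j=0}^\infty w(j,k)<\infty$, the 2D-weighted number operator $S_w$ associated with $w$ is the densely defined operator $S_w\xi=\sum_{j,k=0}^\infty w(j,k)\partial_k^*\partial_j\partial_j^*\partial_k\xi$, with domain $\mathrm{Dom}\,S_w$ the set of all $\xi\in\mathsf{L}^2(Z)$ for which this double series converges naturally. The function $\vartheta_w$ on $\Gamma$ is $$\vartheta_w(\sigma)=\sum_{j=0}^{\infty}\mathbf{1}_{\sigma}(j)w(j,j)+\sum_{j,k=0}^{\infty}\big(1-\mathbf{1}_{\sigma}(j)\big)\mathbf{1}_{\sigma}(k)w(j,k).$$ *)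

(* Defs.v *)
From HB Require Import structures.
From mathcomp Require Import all_boot all_order all_algebra finmap.
From mathcomp Require Import all_classical all_reals all_analysis.
From mathcomp Require Import measurable_realfun complex ring_quotient.

Set Implicit Arguments.
Unset Strict Implicit.
Unset Printing Implicit Defensive.

Import Order.TTheory GRing.Theory Num.Theory.
Import numFieldNormedType.Exports.

Local Open Scope classical_set_scope.
Local Open Scope fset_scope.
Local Open Scope ring_scope.
Local Open Scope complex_scope.
Local Open Scope quotient_scope.

(* The complex Hilbert space L^2(Omega, F, P): square-integrable functions
   T -> R[i], modulo P-almost everywhere equality. *)
Section L2.
Context d (T : measurableType d) (R : realType) (P : probability T R).

Definition sqint : {pred T -> R[i]} := fun f =>
  ((@complex.Re R \o f) \in Lfun P 2%:E) && ((@complex.Im R \o f) \in Lfun P 2%:E).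

Lemma sqint_submod_closed : submod_closed sqint.
Proof.
have RI (a b : R) (f g : T -> R) : f \in Lfun P 2%:E -> g \in Lfun P 2%:E ->
    (fun x => a * f x + b * g x) \in Lfun P 2%:E.
  move=> fL gL.
  have [_ clD] := Lfun_addr_closed P (lee1n 2 : (1 <= 2%:E)%E).
  have -> : (fun x => a * f x + b * g x) = (a \o* f) \+ (b \o* g).
    by apply/funext => x /=; rewrite ![_ * a]mulrC ![_ * b]mulrC.
  by apply: clD; apply: Lfun_scale => //; rewrite ler1n.
split.
  rewrite unfold_in /=; have [cl0 _] := Lfun_addr_closed P (lee1n 2 : (1 <= 2%:E)%E).
  by apply/andP; split; exact: cl0.
move=> a f g /andP[fR fI] /andP[gR gI]; rewrite unfold_in /=.
have [_ clD] := Lfun_addr_closed P (lee1n 2 : (1 <= 2%:E)%E).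
apply/andP; split.
- have -> : @complex.Re R \o (a *: f + g) =
      (fun x => complex.Re a * (@complex.Re R \o f) x + (- complex.Im a) * (@complex.Im R \o f) x)
      \+ (@complex.Re R \o g).
    apply/funext => x /=; rewrite -[(a *: f + g) x]/(a * f x + g x).
    by case: a (f x) (g x) => ? ? [? ?] [? ?] /=; rewrite mulNr.
  by apply: clD => //; exact: RI.
- have -> : @complex.Im R \o (a *: f + g) =
      (fun x => complex.Re a * (@complex.Im R \o f) x + complex.Im a * (@complex.Re R \o f) x)
      \+ (@complex.Im R \o g).
    apply/funext => x /=; rewrite -[(a *: f + g) x]/(a * f x + g x).
    by case: a (f x) (g x) => ? ? [? ?] [? ?].
  by apply: clD => //; exact: RI.
Qed.

HB.instance Definition _ :=
  GRing.isSubmodClosed.Build R[i] (T -> R[i]) sqint sqint_submod_closed.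

Record sqintfun : Type :=
  SqIntFun { sqintfun_val :> T -> R[i] ; _ : sqintfun_val \in sqint }.
HB.instance Definition _ := [isSub for sqintfun_val].
HB.instance Definition _ := [Choice of sqintfun by <:].
HB.instance Definition _ := [SubChoice_isSubLmodule of sqintfun by <:].

Definition ae_zero : {pred sqintfun} := fun f =>
  `[< {ae P, forall x, f x = 0} >].

Lemma ae_zero_zmod_closed : zmod_closed ae_zero.
Proof.
split; first by apply/asboolP; exact: nearW.
move=> f g /asboolP f0 /asboolP g0; apply/asboolP.
apply: filterS2 f0 g0 => x fx gx.
by rewrite -[(f - g) x]/(f x - g x) fx gx subr0.
Qed.

HB.instance Definition _ :=
  GRing.isZmodClosed.Build sqintfun ae_zero ae_zero_zmod_closed.

Definition L2 : Type := {ideal_quot ae_zero}.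
HB.instance Definition _ := Choice.on L2.
HB.instance Definition _ := GRing.Zmodule.on L2.
HB.instance Definition _ := ZmodQuotient.on L2.

Lemma L2_eqP (f g : sqintfun) :
  \pi_L2 f = \pi_L2 g <-> {ae P, forall x, f x = g x}.
Proof.
have E : (f - g \in ae_zero) = (\pi_L2 f == \pi_L2 g) :=
  Quotient.idealrBE _ _ _.
split=> [/eqP|fg].
  rewrite -E => /asboolP; apply: filterS => x.
  by rewrite -[(f - g) x]/(f x - g x) => /eqP; rewrite subr_eq0 => /eqP.
apply/eqP; rewrite -E; apply/asboolP; apply: filterS fg => x fgx.
by rewrite -[(f - g) x]/(f x - g x) fgx subrr.
Qed.

Lemma L2_repr (f : sqintfun) : {ae P, forall x, repr (\pi_L2 f) x = f x}.
Proof. by apply/L2_eqP; rewrite reprK. Qed.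

Definition L2scale (a : R[i]) (u : L2) : L2 := \pi_L2 (a *: repr u).

Lemma L2scale_pi a f : L2scale a (\pi_L2 f) = \pi_L2 (a *: f).
Proof.
apply/L2_eqP; apply: filterS (L2_repr f) => x fx.
by rewrite -[LHS]/(a * repr (\pi_L2 f) x) fx.
Qed.

Lemma L2piD f g : \pi_L2 (f + g) = \pi_L2 f + \pi_L2 g.
Proof. exact: raddfD. Qed.

Lemma L2scaleA a b v : L2scale a (L2scale b v) = L2scale (a * b) v.
Proof.
by elim/quotW: v => f; rewrite (L2scale_pi b) !L2scale_pi scalerA.
Qed.

Lemma L2scale1 : left_id 1 L2scale.
Proof. by elim/quotW => f; rewrite L2scale_pi scale1r. Qed.

Lemma L2scaleDr : right_distributive L2scale +%R.
Proof.
move=> a; elim/quotW => f; elim/quotW => g.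
by rewrite -L2piD !L2scale_pi scalerDr L2piD.
Qed.

Lemma L2scaleDl v : {morph L2scale^~ v : a b / a + b}.
Proof.
by move=> a b; elim/quotW: v => f; rewrite !L2scale_pi scalerDl L2piD.
Qed.

HB.instance Definition _ := GRing.Zmodule_isLmodule.Build R[i] L2
  L2scaleA L2scale1 L2scaleDr L2scaleDl.

Let N2 (h : T -> R) : \bar R := ('N[P]_2%:E[(fun x => (h x)%:E)])%E.

Lemma le_N2 (g h : T -> R) :
  measurable_fun setT g -> measurable_fun setT h ->
  {ae P, forall x, 0 <= g x <= h x} -> (N2 g <= N2 h)%E.
Proof.
move=> mg mh gh; rewrite /N2 unlock gt0_ler_poweR ?in_itv/= ?leey ?integral_ge0//.
have m (k : T -> R) : measurable_fun setT k ->
    measurable_fun setT (fun x => powR `|k x| 2).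
  move=> mk; apply/(@measurableT_comp _ _ _ _ _ _ (fun x : R => x `^ 2)%R) => //.
  exact/measurableT_comp.
apply: ae_ge0_le_integral => //.
  by apply/measurable_EFinP; exact: m.
  by apply/measurable_EFinP; exact: m.
apply: filterS gh => x /andP[g0 gh] _ /=.
by rewrite lee_fin ge0_ler_powR ?nnegrE// !ger0_norm// (le_trans g0).
Qed.

Lemma sqint_norm (f : sqintfun) :
  (fun x => complex.Re `|f x|) \in Lfun P 2%:E.
Proof.
case: f => f /= /andP[fR fI].
have [mR mI] : measurable_fun setT (@complex.Re R \o f) /\
    measurable_fun setT (@complex.Im R \o f).
  by move: fR fI; rewrite !inE => /andP[/[!inE]/= ? _] /andP[/[!inE]/= ? _].
have E : (fun x => complex.Re `|f x|) = @Num.sqrt R \o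
    (fun x => (complex.Re (f x)) ^+ 2 + (complex.Im (f x)) ^+ 2).
  by apply/funext => x; rewrite normc_def.
have m : measurable_fun setT (fun x => complex.Re `|f x|).
  rewrite E; apply: measurableT_comp.
    by apply: continuous_measurable_fun; exact: sqrt_continuous.
  by apply: measurable_funD; apply: measurable_funX.
rewrite inE; apply/andP; split; rewrite inE//= /finite_norm unlock poweR_lty//.
have := Lfun2_integrable_sqr fI.
have := Lfun2_integrable_sqr fR.
move=> /(@integrableD _ _ _ _ _ measurableT) /[apply] /integrableP[_].
apply: le_lt_trans; rewrite ge0_le_integral//=.
- apply/measurable_EFinP.
  apply/(@measurableT_comp _ _ _ _ _ _ (fun x : R => x `^ 2)%R) => //.
  exact/measurableT_comp.
- apply/measurable_EFinP; apply: measurableT_comp => //.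
  by apply: measurable_funD; apply: measurable_funX.
move=> x _; rewrite -[Normc.normc _]/(complex.Re `|f x|) lee_fin normc_def /= powR_mulrn// real_normK ?num_real//.
by rewrite sqr_sqrtr ?addr_ge0 ?sqr_ge0// ler_norm.
Qed.

Lemma measurable_sqint_norm (f : sqintfun) :
  measurable_fun setT (fun x => complex.Re `|f x|).
Proof. by have := sqint_norm f; rewrite inE => /andP[/[!inE]]. Qed.

Lemma Renorm_ge0 (z : R[i]) : 0 <= complex.Re `|z|.
Proof. by rewrite normc_def/= sqrtr_ge0. Qed.

Definition L2norm (u : L2) : R :=
  fine ('N[P]_2%:E[(fun x => (complex.Re `|repr u x|)%:E)])%E.

Lemma L2norm_pi (f : sqintfun) :
  (L2norm (\pi_L2 f))%:E = ('N[P]_2%:E[(fun x => (complex.Re `|f x|)%:E)])%E.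
Proof.
rewrite /L2norm fineK; last first.
  have /andP[_ /[!inE]/= uoo] := sqint_norm (repr (\pi_L2 f)).
  by rewrite fin_numElt (lt_le_trans ltNy0) ?Lnorm_ge0.
apply/eqP; rewrite eq_le; apply/andP.
split; apply: le_N2 => //; try exact: measurable_sqint_norm;
  apply: filterS (L2_repr f) => x ->; by rewrite lexx Renorm_ge0.
Qed.

Lemma ler_L2normD (u v : L2) : L2norm (u + v) <= L2norm u + L2norm v.
Proof.
elim/quotW: u => f; elim/quotW: v => g.
rewrite -lee_fin EFinD -L2piD !L2norm_pi.
apply: (@le_trans _ _ (N2 ((fun x => complex.Re `|f x|) \+
                           (fun x => complex.Re `|g x|)))).
  apply: le_N2; first exact: measurable_sqint_norm.
    by apply: measurable_funD; exact: measurable_sqint_norm.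
  apply: nearW => x; rewrite Renorm_ge0/= -lecR.
  have RR (z : R[i]) : (complex.Re `|z|)%:C = `|z| by rewrite RRe_real.
  by rewrite rmorphD/= !RR; exact: ler_normD.
exact: (eminkowski P (measurable_sqint_norm f) (measurable_sqint_norm g)
  (lee1n 2)).
Qed.

Lemma L2normZ (a : R[i]) (u : L2) :
  (L2norm (a *: u))%:C = `|a| * (L2norm u)%:C.
Proof.
have RR (z : R[i]) : (complex.Re `|z|)%:C = `|z| by rewrite RRe_real.
elim/quotW: u => f; rewrite -[a *: _]/(L2scale a _) L2scale_pi -(RR a) -rmorphM.
congr (_%:C); apply: EFin_inj; rewrite EFinM !L2norm_pi.
have fL := sqint_norm f.
have := LnormZ (Lfun_Sub (lee1n 2) fL) (complex.Re `|a|).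
rewrite (ger0_norm (Renorm_ge0 a)) => fZ; apply: etrans fZ.
congr Lnorm; apply/funext => x /=; congr EFin; apply: complexI.
rewrite -[LHS]/((complex.Re `|a * f x|)%:C) -[RHS]/((complex.Re `|a| * complex.Re `|f x|)%:C).
by rewrite rmorphM !RR normrM.
Qed.

Lemma L2norm0_eq0 (u : L2) : L2norm u = 0 -> u = 0.
Proof.
elim/quotW: u => f f0; move: (L2norm_pi f); rewrite f0 => /esym {}f0.
have pi0 : \pi_L2 0 = 0 :> L2 by exact: raddf0.
rewrite -pi0; apply/L2_eqP.
have mf : measurable_fun setT (EFin \o (fun x => complex.Re `|f x|)).
  by apply/measurable_EFinP; exact: measurable_sqint_norm.
apply: filterS (Lnorm_eq0_eq0 mf _ f0) => // x /(_ I) [fx0].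
by apply/eqP; rewrite -normr_eq0 -(RRe_real (normr_real (f x))) [complex.Re _]fx0.
Qed.

Lemma ler_L2normDC (u v : L2) :
  (L2norm (u + v))%:C <= (L2norm u)%:C + (L2norm v)%:C.
Proof. by rewrite -rmorphD lecR ler_L2normD. Qed.

Lemma L2normC0_eq0 (u : L2) : (L2norm u)%:C = 0 -> u = 0.
Proof. by move=> /complexI /L2norm0_eq0. Qed.

HB.instance Definition _ := @Lmodule_isNormed.Build R[i] L2
  (fun u => (L2norm u)%:C) ler_L2normDC L2normZ L2normC0_eq0.

(* <u, v> = E[conj(u) v]: antilinear in the first argument. *)
Definition L2dot (u v : L2) : R[i] :=
  (\int[P]_x complex.Re ((repr u x)^* * repr v x)) +i*
  (\int[P]_x complex.Im ((repr u x)^* * repr v x)).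

(* The class of [f], with junk value 0 when [f] is not square integrable. *)
Definition L2class (f : T -> R[i]) : L2 := \pi_L2 (insubd 0 f).

End L2.

Section operators.
Context d (T : measurableType d) (R : realType) (P : probability T R).
Implicit Types (A : L2 P -> L2 P) (D : set (L2 P)).

(* A partially defined operator is given by its domain [D] and a total function
   [A] of which only the values on [D] are meaningful. *)
Definition bounded_on D A :=
  exists M : R, forall u, D u -> L2norm (A u) <= M * L2norm u.

Definition opnorm D A : \bar R :=
  ereal_sup [set (L2norm (A u))%:E | u in D `&` [set u | L2norm u <= 1]].

Definition is_adjoint A A' :=
  forall u v, L2dot (A' u) v = L2dot u (A v).

End operators.

Section natural_convergence.
Context {K : numFieldType} {V : normedModType K}.
Implicit Types xi : nat -> nat -> V.

Definition square_sums xi : V^nat :=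
  fun n => \sum_(0 <= j < n.+1) \sum_(0 <= k < n.+1) xi j k.

Definition cvg_naturally xi := cvgn (square_sums xi).

Definition natural_sum xi : V := limn (square_sums xi).

End natural_convergence.

Section bernoulli.
Context d (T : measurableType d) (R : realType) (P : probability T R).
Implicit Types (Z : nat -> {RV P >-> R}) (s : {fset nat}).

Definition theta (p : nat -> R) (n : nat) : R := Num.sqrt ((1 - p n) / p n).

Definition independent_RVs Z :=
  forall s (B : nat -> set R), (forall i, measurable (B i)) ->
    P (\bigcap_(i in [set` s]) (Z i @^-1` B i)) =
    (\prod_(i <- s) P (Z i @^-1` B i))%E.

Definition generated_by Z :=
  @measurable d T =
  <<s \bigcup_n preimage_set_system setT (Z n) measurable >>.

Definition Zprod Z s : L2 P := L2class P (fun x => (\prod_(i <- s) Z i x)%:C).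

(* When the classes Z_sigma are total in L^2(P), this determines [A]. *)
Definition is_annihilation Z (k : nat) (A : {linear L2 P -> L2 P}) :=
  bounded_on setT A /\
  forall s, A (Zprod Z s) = (k \in s)%:R *: Zprod Z (s `\ k).

End bernoulli.

Section weighted_number_operator.
Context d (T : measurableType d) (R : realType) (P : probability T R).
Variables (D Ds : nat -> L2 P -> L2 P) (w : nat -> nat -> R).

Definition wnum_term (u : L2 P) (j k : nat) : L2 P :=
  (w j k)%:C *: Ds k (D j (Ds j (D k u))).

Definition wnum_dom : set (L2 P) := [set u | cvg_naturally (wnum_term u)].

Definition wnum (u : L2 P) : L2 P := natural_sum (wnum_term u).

End weighted_number_operator.

Definition vartheta (R : realType) (w : nat -> nat -> R) (s : {fset nat}) :
    \bar R :=
  (\sum_(0 <= j <oo) ((j \in s)%:R * w j j)%:E +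
   \sum_(0 <= j <oo) \sum_(0 <= k <oo)
     ((1 - (j \in s)%:R) * (k \in s)%:R * w j k)%:E)%E.

(* Main.v *)
(** On the basis vector [Z_sigma] the [(j,k)] summand of [S_w] acts as
multiplication by [w j k] or by [0], and [S_w] acts as multiplication by
[vartheta w sigma]. The square partial sums of [S_w u] therefore have
coefficients [a_n(sigma) * <Z_sigma, u>], where [a_n(sigma)] increases to
[vartheta w sigma]. If [vartheta] is bounded by [C], Parseval gives
[||s_n u|| <= C ||u||]; since [s_n] converges on finite combinations of basis
vectors, it converges everywhere by completeness. Conversely the eigenvalues
of a bounded operator are bounded by its norm.

Totality of the [Z_sigma]: each [Z_n] takes two values almost surely, so the
indicator of a cylinder event is almost surely a linear combination of finitely
many [Z_sigma]; a function orthogonal to all [Z_sigma] thus has integral zero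
over every cylinder, hence, by Dynkin's theorem, over every event. *)
Require Import Defs.
From HB Require Import structures.
From mathcomp Require Import all_boot all_order all_algebra finmap.
From mathcomp Require Import all_classical all_reals all_analysis.
From mathcomp Require Import measurable_realfun complex.
From mathcomp Require Import ring lra.

Set Implicit Arguments.
Unset Strict Implicit.
Unset Printing Implicit Defensive.

Import Order.TTheory GRing.Theory Num.Theory.
Import numFieldNormedType.Exports.

Local Open Scope classical_set_scope.
Local Open Scope ring_scope.

(** * The inner product of [L2] *)

Section L2_inner_product.
Context d (T : measurableType d) (R : realType) (P : probability T R).
Local Open Scope complex_scope.
Local Open Scope quotient_scope.
Implicit Types (u v : L2 P) (f g : sqintfun P).

Lemma realcM (a b : R) : (a * b)%:C = a%:C * b%:C.
Proof. exact: rmorphM. Qed.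

Lemma sqintfunDE f g x : (f + g) x = f x + g x.
Proof. by []. Qed.

Lemma sqintfunBE f g x : (f - g) x = f x - g x.
Proof. by []. Qed.

Lemma sqintfunZE a f x : (a *: f) x = a * f x.
Proof. by []. Qed.

Lemma sqint_parts f : (fun x => complex.Re (f x)) \in Lfun P 2%:E /\
  (fun x => complex.Im (f x)) \in Lfun P 2%:E.
Proof. by case: f => f /= /andP[]. Qed.

Lemma measurable_sqint_parts f :
  measurable_fun setT (fun x => complex.Re (f x)) /\
  measurable_fun setT (fun x => complex.Im (f x)).
Proof.
have [] := sqint_parts f.
by rewrite !inE => /andP[/[!inE]/= ? _] /andP[/[!inE]/= ? _].
Qed.

Lemma Re_mulconj (a b : R[i]) : complex.Re (a^* * b) =
  complex.Re a * complex.Re b + complex.Im a * complex.Im b.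
Proof. by case: a b => [? ?] [? ?] /=; ring. Qed.

Lemma Im_mulconj (a b : R[i]) : complex.Im (a^* * b) =
  complex.Re a * complex.Im b - complex.Im a * complex.Re b.
Proof. by case: a b => [? ?] [? ?] /=; ring. Qed.

Lemma Lfun2_mul_integrable (a b : T -> R) : a \in Lfun P 2%:E -> b \in Lfun P 2%:E ->
  P.-integrable setT (EFin \o (fun x => a x * b x)).
Proof. by move=> aL bL; apply/Lfun1_integrable; exact: Lfun2_mul_Lfun1. Qed.

Lemma integrable_mulconj f g :
  P.-integrable setT (EFin \o (fun x => complex.Re ((f x)^* * g x))) /\
  P.-integrable setT (EFin \o (fun x => complex.Im ((f x)^* * g x))).
Proof.
have [fR fI] := sqint_parts f; have [gR gI] := sqint_parts g.
split.
  rewrite (_ : _ \o _ = (EFin \o (fun x => complex.Re (f x) * complex.Re (g x))%R) \+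
      (EFin \o (fun x => complex.Im (f x) * complex.Im (g x))%R))%E.
    by apply: integrableD => //; exact: Lfun2_mul_integrable.
  by apply/funext => x /=; rewrite -EFinD -Re_mulconj.
rewrite (_ : _ \o _ = (EFin \o (fun x => complex.Re (f x) * complex.Im (g x))%R) \-
    (EFin \o (fun x => complex.Im (f x) * complex.Re (g x))%R))%E.
  by apply: integrableB => //; exact: Lfun2_mul_integrable.
by apply/funext => x /=; rewrite -EFinB -Im_mulconj.
Qed.

Lemma ae_eq_Rintegral (a b : T -> R) :
  measurable_fun setT a -> measurable_fun setT b ->
  {ae P, forall x, a x = b x} -> \int[P]_x a x = \int[P]_x b x.
Proof.
move=> ma mb ab; congr fine; apply: ae_eq_integral => //.
- exact/measurable_EFinP.
- exact/measurable_EFinP.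
- by apply: filterS ab => x /= ->.
Qed.

(** [L2dot] is defined through chosen representatives. These agree almost everywhere with [f] and
    [g], so any representatives may be used, and the algebraic rules below reduce to pointwise
    identities. *)
Lemma L2dot_pi f g : L2dot (\pi_(L2 P) f) (\pi_(L2 P) g) =
  (\int[P]_x complex.Re ((f x)^* * g x)) +i* (\int[P]_x complex.Im ((f x)^* * g x)).
Proof.
rewrite /L2dot.
have H (h k : sqintfun P) : measurable_fun setT (fun x => complex.Re ((h x)^* * k x)) /\
   measurable_fun setT (fun x => complex.Im ((h x)^* * k x)).
  have [/measurable_int/measurable_EFinP ? /measurable_int/measurable_EFinP ?] :=
    integrable_mulconj h k.
  by split.
congr (_ +i* _); apply: ae_eq_Rintegral;
  try exact: (H _ _).1; try exact: (H _ _).2;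
  by apply: filterS2 (L2_repr f) (L2_repr g) => x -> ->.
Qed.

Lemma L2dotC u v : L2dot v u = (L2dot u v)^*.
Proof.
have [_ mI] := integrable_mulconj (repr u) (repr v).
apply/eqP; rewrite eq_complex /=; apply/andP; split; apply/eqP.
  by apply: eq_Rintegral => x _; rewrite !Re_mulconj; ring.
rewrite -mulN1r -RintegralZl//.
by apply: eq_Rintegral => x _; rewrite !Im_mulconj; ring.
Qed.

Lemma L2dotDr u v w : L2dot u (v + w) = L2dot u v + L2dot u w.
Proof.
elim/quotW: u => f; elim/quotW: v => g; elim/quotW: w => h.
(* The sum becomes an opaque [k] known only by its values, so that it is treated as a single
   representative. *)
rewrite -L2piD; move: (g + h) (sqintfunDE g h) => k kE; rewrite !L2dot_pi.
have [? ?] := integrable_mulconj f g; have [? ?] := integrable_mulconj f h.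
apply/eqP; rewrite eq_complex /=; apply/andP; split; apply/eqP;
  rewrite -RintegralD//; apply: eq_Rintegral => x _;
  rewrite kE ?Re_mulconj ?Im_mulconj;
  by case: (f x) (g x) (h x) => ? ? [? ?] [? ?] /=; ring.
Qed.

Lemma L2dotZr a u v : L2dot u (a *: v) = a * L2dot u v.
Proof.
elim/quotW: u => f; elim/quotW: v => g.
rewrite -[a *: _]/(L2scale a _) L2scale_pi.
move: (a *: g) (sqintfunZE a g) => k kE; rewrite !L2dot_pi.
have [iR iI] := integrable_mulconj f g.
have Z (b : R) (h : T -> R) : P.-integrable setT (EFin \o h) ->
    P.-integrable setT (EFin \o (fun x => b * h x)).
  by move=> ih; exact: (integrableZl measurableT b ih).
case: a kE => a b kE; apply/eqP; rewrite eq_complex /=; apply/andP; split; apply/eqP.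
  rewrite -!RintegralZl// -RintegralB//; try exact: Z.
  apply: eq_Rintegral => x _.
  rewrite kE ?Re_mulconj ?Im_mulconj.
  by case: (f x) (g x) => ? ? [? ?] /=; ring.
rewrite -!RintegralZl// -RintegralD//; try exact: Z.
apply: eq_Rintegral => x _.
rewrite kE ?Re_mulconj ?Im_mulconj.
by case: (f x) (g x) => ? ? [? ?] /=; ring.
Qed.

Lemma L2norm_ge0 u : 0 <= L2norm u.
Proof. by rewrite /L2norm fine_ge0 ?Lnorm_ge0. Qed.

Lemma L2norm_sqr_pi f :
  L2norm (\pi_(L2 P) f) ^+ 2 =
  \int[P]_x (complex.Re (f x) ^+ 2 + complex.Im (f x) ^+ 2).
Proof.
have two0 : 2 != 0 :> R by rewrite pnatr_eq0.
have := powR_Lnorm P (fun x => (complex.Re `|f x|)%:E) two0.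
rewrite -L2norm_pi poweR_EFin powR_mulrn ?L2norm_ge0//.
move=> /(congr1 fine) /= ->; congr fine; apply: eq_integral => x _.
rewrite -[Normc.normc _]/(complex.Re `|f x|) normc_def /= powR_mulrn//.
by rewrite real_normK ?num_real// sqr_sqrtr ?addr_ge0 ?sqr_ge0.
Qed.

Lemma L2dot_norm u : L2dot u u = (L2norm u ^+ 2)%:C.
Proof.
elim/quotW: u => f; rewrite L2dot_pi L2norm_sqr_pi.
apply/eqP; rewrite eq_complex /=; apply/andP; split; apply/eqP.
  by apply: eq_Rintegral => x _; rewrite Re_mulconj; ring.
rewrite (_ : (fun x => _) = cst 0) ?Rintegral_cst ?mul0r//.
by apply/funext => x; rewrite Im_mulconj /=; ring.
Qed.

Lemma L2dot0r u : L2dot u 0 = 0.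
Proof. by rewrite -(scale0r 0) L2dotZr mul0r. Qed.

Lemma L2dotNr u v : L2dot u (- v) = - L2dot u v.
Proof. by rewrite -scaleN1r L2dotZr mulN1r. Qed.

Lemma L2dotBr u v w : L2dot u (v - w) = L2dot u v - L2dot u w.
Proof. by rewrite L2dotDr L2dotNr. Qed.

Lemma L2dot_sumr (I : Type) (r : seq I) (Q : pred I) (F : I -> L2 P) u :
  L2dot u (\sum_(i <- r | Q i) F i) = \sum_(i <- r | Q i) L2dot u (F i).
Proof. by apply: (big_morph _ (L2dotDr u)); exact: L2dot0r. Qed.

Lemma L2dotDl u v w : L2dot (u + v) w = L2dot u w + L2dot v w.
Proof. by rewrite (L2dotC w) L2dotDr rmorphD (L2dotC w u) (L2dotC w v). Qed.

Lemma L2dotNl u v : L2dot (- u) v = - L2dot u v.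
Proof. by rewrite (L2dotC v) L2dotNr rmorphN (L2dotC v u). Qed.

Lemma L2dotZl a u v : L2dot (a *: u) v = a^* * L2dot u v.
Proof. by rewrite (L2dotC v) L2dotZr rmorphM (L2dotC v u). Qed.

Lemma L2dot_suml (J : Type) (r : seq J) (F : J -> L2 P) u :
  L2dot (\sum_(i <- r) F i) u = \sum_(i <- r) L2dot (F i) u.
Proof.
apply: (big_morph (fun v => L2dot v u)) => [v w|]; first exact: L2dotDl.
by rewrite L2dotC L2dot0r conjc0.
Qed.

Lemma L2normN u : L2norm (- u) = L2norm u.
Proof.
apply/eqP; rewrite -(eqrXn2 (n:=2))// ?L2norm_ge0//.
by apply/eqP/complexI; rewrite -!L2dot_norm L2dotNl L2dotNr opprK.
Qed.

Lemma L2normB u v : L2norm (u - v) = L2norm (v - u).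
Proof. by rewrite -L2normN opprB. Qed.

Lemma L2norm_triangle u v w : L2norm (u - w) <= L2norm (u - v) + L2norm (v - w).
Proof. by rewrite -[u - w](subrKA v) ler_L2normD. Qed.

Lemma L2norm_pythagoras u v : L2dot u v = 0 ->
  L2norm (u + v) ^+ 2 = L2norm u ^+ 2 + L2norm v ^+ 2.
Proof.
move=> uv; apply: complexI; rewrite rmorphD/= -!L2dot_norm L2dotDl !L2dotDr uv.
by rewrite (L2dotC u v) uv rmorph0 addr0 add0r.
Qed.

(** Norm convergence with real tolerances; the normed module structure on [L2 P] takes them in
    [R[i]], and [cvgn_L2P] links the two. *)
Definition L2cvg (s : nat -> L2 P) (u : L2 P) := forall e : R, 0 < e ->
  exists N, forall n, (N <= n)%N -> L2norm (s n - u) <= e.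

Lemma cvgn_L2P (s : nat -> L2 P) (u : L2 P) : s @ \oo --> u <-> L2cvg s u.
Proof.
split.
  move=> /cvgrPdist_le su e e0.
  have /su : (0 : R[i]) < e%:C by rewrite ltcR.
  case=> N _ sN; exists N => n /sN.
  by rewrite -[ `|_| ]/((L2norm _)%:C) lecR L2normB.
move=> su; apply/cvgrPdist_le => e e0.
(* A positive element of [R[i]] has zero imaginary part. *)
have eE : e = (complex.Re e)%:C by rewrite RRe_real// gtr0_real.
have /su[N sN] : 0 < complex.Re e by rewrite -ltcR -eE.
exists N => // n /= /sN nN.
by rewrite eE -[ `|_| ]/((L2norm _)%:C) lecR L2normB.
Qed.

Lemma L2cvg_norm_le (s : nat -> L2 P) (u : L2 P) (C : R) :
  L2cvg s u -> (forall n, L2norm (s n) <= C) -> L2norm u <= C.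
Proof.
move=> su sC; apply/ler_addgt0Pr => e /su[N /(_ N (leqnn N))]; rewrite L2normB.
move=> uN; rewrite -[u](subrK (s N)) (le_trans (ler_L2normD _ _))//.
by rewrite addrC lerD.
Qed.

End L2_inner_product.

(** * Completeness of [L2] *)

Section L2_completeness.
Context d (T : measurableType d) (R : realType) (P : probability T R).
Local Open Scope complex_scope.
Local Open Scope quotient_scope.

Lemma Lfun2I (f : T -> R) : measurable_fun setT f ->
  (\int[P]_x ((f x) ^+ 2)%:E < +oo)%E -> f \in Lfun P 2%:E.
Proof.
move=> mf foo; rewrite inE; apply/andP; split; rewrite inE//= /finite_norm.
rewrite unlock poweR_lty//; apply: le_lt_trans foo.
rewrite le_eqVlt; apply/orP; left; apply/eqP; apply: eq_integral => x _ /=.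
by rewrite powR_mulrn// real_normK ?num_real.
Qed.

(* AM-GM: [2 |h| <= e + h^2 / e]. *)
Lemma integral_norm_le_sqr (h : T -> R) (e : R) : 0 < e -> measurable_fun setT h ->
  (\int[P]_x ((h x) ^+ 2)%:E <= (e ^+ 2)%:E)%E ->
  (\int[P]_x `|h x|%:E <= e%:E)%E.
Proof.
move=> e0 mh he.
have mh2 : measurable_fun setT (EFin \o (fun x => h x ^+ 2)).
  by apply/measurable_EFinP; exact: measurable_funX.
apply: (@le_trans _ _ (\int[P]_x ((e / 2)%:E + ((2 * e)^-1)%:E * (h x ^+ 2)%:E))%E).
  apply: ge0_le_integral => //.
  - by apply/measurable_EFinP; exact: measurableT_comp.
  - by apply: emeasurable_funD => //; exact: measurable_funeM.
  - move=> x _; rewrite lee_fin -(real_normK (num_real (h x))).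
    rewrite -subr_ge0 (_ : _ - _ = (2 * e)^-1 * (`|h x| - e) ^+ 2).
      by rewrite mulr_ge0 ?sqr_ge0// invr_ge0 mulr_ge0// ltW.
    by field; rewrite gt_eqF.
rewrite ge0_integralD//; first last.
- exact: measurable_funeM.
- by move=> x _; rewrite lee_fin mulr_ge0 ?sqr_ge0// invr_ge0 mulr_ge0// ltW.
- by move=> x _; rewrite lee_fin divr_ge0// ltW.
rewrite integral_cst// [X in (_ * X)%E](_ : _ = 1%E); last exact: probability_setT.
rewrite mule1 ge0_integralZl//; last 2 first.
- by move=> x _; rewrite lee_fin sqr_ge0.
- by rewrite lee_fin invr_ge0 mulr_ge0// ltW.
apply: (@le_trans _ _ ((e / 2)%:E + ((2 * e)^-1)%:E * (e ^+ 2)%:E)%E).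
  by rewrite leeD2l// lee_pmul2l// lte_fin invr_gt0 mulr_gt0.
rewrite -EFinM -EFinD lee_fin le_eqVlt; apply/orP; left; apply/eqP; field.
by rewrite gt_eqF.
Qed.

(** The series of absolute increments has integral at most 2, hence is finite almost everywhere;
    there the telescoping series converges absolutely. *)
Lemma ae_cvg_of_summable (a : nat -> T -> R) :
  (forall k, measurable_fun setT (a k)) ->
  (forall k, (\int[P]_x `|a k.+1 x - a k x|%:E <= ((2^-1) ^+ k)%:E)%E) ->
  exists2 b : T -> R, measurable_fun setT b &
    {ae P, forall x, a ^~ x @ \oo --> b x}.
Proof.
move=> ma aeps.
have mD k : measurable_fun setT (fun x => `|a k.+1 x - a k x|%:E).
  apply/measurable_EFinP; apply: measurableT_comp => //.
  exact: measurable_funB.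
have sumoo : (\int[P]_x (\sum_(k <oo) `|a k.+1 x - a k x|%:E) < +oo)%E.
  rewrite integral_nneseries//.
  apply: (@le_lt_trans _ _ (\sum_(k <oo) ((2^-1) ^+ k)%:E)%E).
    by apply: lee_nneseries => // k _ _; exact: integral_ge0.
  apply: (@le_lt_trans _ _ 2%:E); last exact: ltry.
  apply: lime_le; first exact: is_cvg_nneseries.
  apply: nearW => n; rewrite sumEFin lee_fin.
  suff -> : \sum_(0 <= k < n) (2^-1) ^+ k = 2 - 2 * (2^-1) ^+ n :> R.
    by rewrite gerBl mulr_ge0// exprn_ge0// invr_ge0.
  elim: n => [|n IH]; first by rewrite big_geq// expr0 mulr1 subrr.
  by rewrite big_nat_recr//= IH exprS; field.
have aefin : {ae P, forall x, (\sum_(k <oo) `|a k.+1 x - a k x|%:E < +oo)%E}.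
  have mS : measurable_fun setT (fun x => \sum_(k <oo) `|a k.+1 x - a k x|%:E)%E.
    by apply: ge0_emeasurable_sum.
  have iS : P.-integrable setT (fun x => \sum_(k <oo) `|a k.+1 x - a k x|%:E)%E.
    apply/integrableP; split => //.
    under eq_integral => x _ do rewrite gee0_abs ?nneseries_ge0//.
    exact: sumoo.
  apply: filterS (integrable_ae measurableT iS) => x /(_ I).
  by rewrite fin_numElt => /andP[].
have acv : {ae P, forall x, cvgn (a ^~ x)}.
  apply: filterS aefin => x xoo.
  have scv : cvgn (series (fun k => a k.+1 x - a k x)).
    apply: normed_cvg; apply: nondecreasing_is_cvgn.
      apply/nondecreasing_seqP => n.
      by rewrite /= /normed_series_of/= !seriesEnat/= big_nat_recr//= lerDl.
    exists (fine (\sum_(k <oo) `|a k.+1 x - a k x|%:E)%E) => _ [n _ <-].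
    rewrite -lee_fin fineK; last first.
      by rewrite ge0_fin_numE// nneseries_ge0.
    rewrite /normed_series_of/= seriesEnat/= -sumEFin.
    exact: nneseries_lim_ge.
  rewrite (_ : a ^~ x = (fun n => a 0%N x + series (fun k => a k.+1 x - a k x) n)).
    by apply: is_cvgD => //; exact: is_cvg_cst.
  by apply/funext => n; rewrite seriesEnat/= telescope_sumr//; ring.
have [N [mN N0 cN]] := acv.
have inN x : ~ N x -> cvgn (a ^~ x) by move=> nN; apply: contrapT => /cN.
(* Cutting off on the null set [N] makes the sequence converge everywhere, which gives a measurable
   limit. *)
pose a' n x := \1_(~` N) x * a n x.
have ma' n : measurable_fun setT (a' n).
  by apply: measurable_funM => //; apply: measurable_indic; exact: measurableC.
pose b x := \1_(~` N) x * limn (a ^~ x).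
exists b.
  apply: (measurable_fun_cvg ma') => x _; rewrite /b indicE.
  have [xN|xN] := boolP (x \in ~` N).
    rewrite (_ : a' ^~ x = fun n => 1 * a n x).
      by apply: cvgM; [exact: cvg_cst|exact/inN/set_mem].
    by apply/funext => n; rewrite /a' indicE xN.
  rewrite mul0r (_ : a' ^~ x = cst 0); first exact: cvg_cst.
  by apply/funext => n; rewrite /a' indicE (negbTE xN) mul0r.
exists N; split => // x xn; apply: contrapT => nN; apply: xn.
by rewrite /= /b indicE mem_set//= mul1r; exact: inN.
Qed.

(** The geometric rate gives an almost sure limit, and Fatou's lemma carries the bound on
    [a k - a n] over to it as [n] grows. *)
Lemma L2_fast_cauchy (a : nat -> T -> R) :
  (forall k, measurable_fun setT (a k)) ->
  (forall k n, (k <= n)%N ->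
    (\int[P]_x ((a k x - a n x) ^+ 2)%:E <= (((2^-1) ^+ k) ^+ 2)%:E)%E) ->
  exists2 b : T -> R, measurable_fun setT b &
    forall k, (\int[P]_x ((a k x - b x) ^+ 2)%:E <= (((2^-1) ^+ k) ^+ 2)%:E)%E.
Proof.
move=> ma aC.
have [|b mb ab] := ae_cvg_of_summable ma.
  move=> k; apply: integral_norm_le_sqr; first by rewrite exprn_gt0// invr_gt0.
    exact: measurable_funB.
  apply: le_trans (aC k k.+1 (leqnSn k)).
  under eq_integral => x _ do rewrite -sqrrN opprB.
  exact: lexx.
exists b => // k.
(* The shift by [k] makes the Cauchy bound available for every [n]. *)
pose h n x := ((a k x - a (n + k)%N x) ^+ 2)%:E.
have mh n : measurable_fun setT (h n).
  by apply/measurable_EFinP; apply: measurable_funX; exact: measurable_funB.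
apply: (@le_trans _ _ (\int[P]_x limn_einf (h ^~ x))%E).
  apply: ae_ge0_le_integral => //.
  - by move=> x _; rewrite lee_fin sqr_ge0.
  - by apply/measurable_EFinP; apply: measurable_funX; exact: measurable_funB.
  - move=> x _; rewrite limn_einf_lim; apply: lime_ge; first exact: is_cvg_einfs.
    apply: nearW => n; apply: le_ereal_inf_tmp => _ [m _ <-].
    by rewrite lee_fin sqr_ge0.
  - apply: measurableT_comp => //; apply: measurable_fun_limn_esup => n.
    exact: measurableT_comp.
  apply: filterS ab => x abx _.
  rewrite (_ : limn_einf _ = ((a k x - b x) ^+ 2)%:E)//.
  have hc : h ^~ x @ \oo --> ((a k x - b x) ^+ 2)%:E.
    apply: cvg_EFin; first exact: nearW.
    apply: (@cvg_comp _ _ _ _ (fun y => y ^+ 2)); last exact: exprn_continuous.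
    apply: cvgB; first exact: cvg_cst.
    by have := abx; rewrite -(cvg_shiftn k).
  have [-> _] := cvg_limn_einf_sup hc.
  by [].
apply: le_trans (fatou _ _ _ _) _ => //.
  by move=> n x _; rewrite lee_fin sqr_ge0.
rewrite limn_einf_lim; apply: lime_le; first exact: is_cvg_einfs.
apply: nearW => n; apply: ereal_inf_le; exists (\int[P]_x h n x)%E.
  by exists n => /=.
exact/aC/leq_addl.
Qed.

Lemma L2norm_sqr_piE (f : sqintfun P) : ((L2norm (\pi_(L2 P) f) ^+ 2)%:E =
  \int[P]_x (complex.Re (f x) ^+ 2)%:E + \int[P]_x (complex.Im (f x) ^+ 2)%:E)%E.
Proof.
have [fR fI] := sqint_parts f; have [mR mI] := measurable_sqint_parts f.
have iR := Lfun2_integrable_sqr fR; have iI := Lfun2_integrable_sqr fI.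
rewrite L2norm_sqr_pi RintegralD// EFinD !fineK//; exact: integrable_fin_num.
Qed.

Lemma ex_half_exp_lt (e : R) : 0 < e -> exists k, (2^-1) ^+ k < e.
Proof.
move=> e0; have half1 : `|2^-1| < 1 :> R.
  by rewrite ger0_norm ?invr_ge0// invf_lt1// ltr1n.
have /cvgrPdist_lt/(_ _ e0)[k _ /(_ _ (leqnn k))] := cvg_geometric 1 half1.
by rewrite /= sub0r normrN mul1r ger0_norm ?exprn_ge0 ?invr_ge0//; exists k.
Qed.

(** Riesz-Fischer: a subsequence with gaps [2^-k] has limits for its real and imaginary parts
    separately, and the Cauchy property extends the convergence to the whole sequence. *)
Theorem L2_complete (s : nat -> L2 P) :
  (forall e : R, 0 < e -> exists N, forall m n, (N <= m)%N -> (N <= n)%N ->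
    L2norm (s m - s n) <= e) ->
  exists u, L2cvg s u.
Proof.
move=> sC.
have eps0 k : 0 < (2^-1) ^+ k :> R by rewrite exprn_gt0// invr_gt0.
have /choice[N NP] : forall k, exists N, forall m n, (N <= m)%N -> (N <= n)%N ->
    L2norm (s m - s n) <= (2^-1) ^+ k by move=> k; exact: sC.
(* Summing the thresholds makes [phi] monotone while keeping it above [N]. *)
pose phi k := (\sum_(i < k.+1) N i)%N.
have Nphi k : (N k <= phi k)%N by rewrite /phi big_ord_recr leq_addl.
have phi_homo : {homo phi : k n / (k <= n)%N}.
  by apply: homo_leq leq_trans _ => // k; rewrite /phi [leqRHS]big_ord_recr leq_addr.
pose a k := repr (s (phi k)).
have aE k : s (phi k) = \pi_(L2 P) (a k) by rewrite reprK.
have aC k n : (k <= n)%N -> L2norm (\pi_(L2 P) (a k - a n)) <= (2^-1) ^+ k.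
  move=> kn; rewrite (_ : \pi_(L2 P) _ = s (phi k) - s (phi n)).
    by apply: NP => //; exact: leq_trans (phi_homo _ _ kn).
  by rewrite !aE; exact: raddfB.
have aC2 k n : (k <= n)%N ->
    ((L2norm (\pi_(L2 P) (a k - a n)) ^+ 2)%:E <= (((2^-1) ^+ k) ^+ 2)%:E)%E.
  by move=> kn; rewrite lee_fin lerXn2r ?nnegrE ?L2norm_ge0 ?aC// ltW.
have [bR mbR abR] : exists2 b : T -> R, measurable_fun setT b & forall k,
    (\int[P]_x ((complex.Re (a k x) - b x) ^+ 2)%:E <= (((2^-1) ^+ k) ^+ 2)%:E)%E.
  apply: (@L2_fast_cauchy (fun k x => complex.Re (a k x))).
    by move=> k; have [] := measurable_sqint_parts (a k).
  move=> k n kn; apply: le_trans (aC2 _ _ kn).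
  rewrite L2norm_sqr_piE -[leLHS]adde0 leeD ?integral_ge0//.
    rewrite le_eqVlt; apply/orP; left; apply/eqP; apply: eq_integral => x _.
    by rewrite sqintfunBE; case: (a k x) (a n x) => ? ? [].
  by move=> x _; rewrite lee_fin sqr_ge0.
have [bI mbI abI] : exists2 b : T -> R, measurable_fun setT b & forall k,
    (\int[P]_x ((complex.Im (a k x) - b x) ^+ 2)%:E <= (((2^-1) ^+ k) ^+ 2)%:E)%E.
  apply: (@L2_fast_cauchy (fun k x => complex.Im (a k x))).
    by move=> k; have [] := measurable_sqint_parts (a k).
  move=> k n kn; apply: le_trans (aC2 _ _ kn).
  rewrite L2norm_sqr_piE -[leLHS]add0e leeD ?integral_ge0//.
    by move=> x _; rewrite lee_fin sqr_ge0.
  rewrite le_eqVlt; apply/orP; left; apply/eqP; apply: eq_integral => x _.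
  by rewrite sqintfunBE; case: (a k x) (a n x) => ? ? [].
(* The limit is square integrable because it differs from [a 0] by a square integrable function. *)
have Lsub (g b : T -> R) : g \in Lfun P 2%:E -> measurable_fun setT b ->
    (\int[P]_x ((g x - b x) ^+ 2)%:E <= (((2^-1) ^+ 0) ^+ 2)%:E)%E ->
    b \in Lfun P 2%:E.
  move=> gL mb gb; have mg : measurable_fun setT g.
    by move: gL; rewrite inE => /andP[/[!inE]].
  have gbL : (fun x => g x - b x) \in Lfun P 2%:E.
    apply: Lfun2I; first exact: measurable_funB.
    by apply: le_lt_trans gb _; exact: ltry.
  have [_ clD] := Lfun_addr_closed P (lee1n 2 : (1 <= 2%:E)%E).
  have clN := @Lfun_oppr_closed _ _ _ P 2%:E.
  rewrite (_ : b = g \+ - (fun x => g x - b x)).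
    by apply: clD => //; exact: clN.
  by apply/funext => x /=; rewrite opprB addrC subrK.
have fL : (fun x => bR x +i* bI x) \in @sqint _ _ R P.
  have [aR aI] := sqint_parts (a 0%N).
  by apply/andP; split; [exact: Lsub aR mbR (abR 0%N)|exact: Lsub aI mbI (abI 0%N)].
pose f := SqIntFun fL.
(* The real and imaginary parts each contribute [(2^-k)^2]; the factor 2 is a crude bound for the
   square root of 2. *)
have af k : L2norm (s (phi k) - \pi_(L2 P) f) <= 2 * (2^-1) ^+ k.
  rewrite -(@ler_pXn2r _ 2)// ?nnegrE ?L2norm_ge0 ?mulr_ge0 ?(ltW (eps0 k))//.
  rewrite (_ : _ - _ = \pi_(L2 P) (a k - f)); last by rewrite aE; apply/esym/raddfB.
  rewrite -lee_fin L2norm_sqr_piE.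
  apply: (@le_trans _ _ ((((2^-1) ^+ k) ^+ 2)%:E + (((2^-1) ^+ k) ^+ 2)%:E)%E).
    apply: leeD.
      apply: le_trans (abR k); rewrite le_eqVlt; apply/orP; left; apply/eqP.
      by apply: eq_integral => x _; rewrite sqintfunBE /=; case: (a k x).
    apply: le_trans (abI k); rewrite le_eqVlt; apply/orP; left; apply/eqP.
    by apply: eq_integral => x _; rewrite sqintfunBE /=; case: (a k x).
  rewrite -EFinD lee_fin exprMn -subr_ge0.
  rewrite (_ : _ - _ = 2 * (2^-1 ^+ k) ^+ 2); last by ring.
  by rewrite mulr_ge0// sqr_ge0.
exists (\pi_(L2 P) f) => e e0.
(* The two distances below add up to [3 * 2^-k], hence the tolerance [e / 3]. *)
have [k ke] := ex_half_exp_lt (divr_gt0 e0 (ltr0Sn R 2)).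
exists (phi k) => n phin.
apply: le_trans (L2norm_triangle _ (s (phi k)) _) _.
apply: (@le_trans _ _ ((2^-1) ^+ k + 2 * (2^-1) ^+ k)).
  by rewrite lerD// NP// (leq_trans (Nphi k)).
rewrite (_ : _ + _ = 3 * (2^-1) ^+ k); last by ring.
by rewrite mulrC -ler_pdivlMr// ltW.
Qed.

End L2_completeness.

(** * Countable orthonormal bases *)

Section orthonormal_basis.
Context d (T : measurableType d) (R : realType) (P : probability T R).
Local Open Scope complex_scope.
Context (I : countType) (e : I -> L2 P).
Hypothesis e_orthonormal : forall i j, L2dot (e i) (e j) = (i == j)%:R.
Hypothesis e_total : forall u, (forall i, L2dot (e i) u = 0) -> u = 0.
Implicit Types (u v x y : L2 P) (r : seq I).

(** A finite exhaustion of [I] by [pickle] codes below [N]; codes of no element are dropped, so [I]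
    may be finite or infinite. *)
Definition initial_seq (N : nat) : seq I := pmap (@pickle_inv I) (iota 0 N).

Lemma initial_seq_uniq N : uniq (initial_seq N).
Proof. exact: (pmap_uniq (@pickle_invK I) (iota_uniq 0 N)). Qed.

Lemma mem_initial_seq N i : (i \in initial_seq N) = (choice.pickle i < N)%N.
Proof.
rewrite mem_pmap; apply/mapP/idP => [[n]|iN].
  rewrite mem_iota add0n /= => nN iE; have := @pickle_invK I n.
  by rewrite -iE /= => ->.
by exists (choice.pickle i); rewrite ?mem_iota// pickleK_inv.
Qed.

Lemma L2dot_lincomb r (c : I -> R[i]) i : uniq r ->
  L2dot (e i) (\sum_(j <- r) c j *: e j) = (i \in r)%:R * c i.
Proof.
move=> ur; rewrite L2dot_sumr.
under eq_bigr => j _ do rewrite L2dotZr e_orthonormal.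
have [ir|ir] := boolP (i \in r).
  rewrite (bigD1_seq i)//= eqxx mulr1 big1 ?addr0 ?mul1r// => j /negbTE.
  by rewrite eq_sym => ->; rewrite mulr0.
rewrite big_seq big1 ?mul0r// => j jr.
by case: eqVneq ir => [->|_ _]; rewrite ?jr ?mulr0.
Qed.

Lemma L2norm_lincomb r (c : I -> R[i]) : uniq r ->
  (L2norm (\sum_(j <- r) c j *: e j) ^+ 2)%:C = \sum_(j <- r) (c j)^* * c j.
Proof.
move=> ur; rewrite -L2dot_norm L2dot_suml [LHS]big_seq [RHS]big_seq; apply: eq_bigr => j jr.
by rewrite L2dotZl L2dot_lincomb// jr mul1r.
Qed.

Definition fourier_sum (N : nat) u := \sum_(i <- initial_seq N) L2dot (e i) u *: e i.

Lemma L2dot_fourier_sum N u i :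
  L2dot (e i) (fourier_sum N u) = (choice.pickle i < N)%:R * L2dot (e i) u.
Proof. by rewrite L2dot_lincomb ?initial_seq_uniq// mem_initial_seq. Qed.

Lemma fourier_sum_orthogonal N M u : (N <= M)%N ->
  L2dot (fourier_sum N u) (fourier_sum M u - fourier_sum N u) = 0.
Proof.
move=> NM; rewrite L2dot_suml big_seq big1// => i.
rewrite mem_initial_seq => iN; rewrite L2dotZl L2dotBr !L2dot_fourier_sum iN.
by rewrite (leq_trans iN NM) subrr mulr0.
Qed.

Lemma bessel N u : L2norm (fourier_sum N u) <= L2norm u.
Proof.
rewrite -(@ler_pXn2r _ 2)// ?nnegrE ?L2norm_ge0//.
rewrite -[u in leRHS](subrKC (fourier_sum N u)) L2norm_pythagoras ?lerDl ?sqr_ge0//.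
rewrite L2dot_suml big_seq big1// => i; rewrite mem_initial_seq => iN.
by rewrite L2dotZl L2dotBr !L2dot_fourier_sum iN mul1r subrr mulr0.
Qed.

Lemma fourier_sum_sub N M u : (N <= M)%N ->
  L2norm (fourier_sum M u - fourier_sum N u) ^+ 2 =
  L2norm (fourier_sum M u) ^+ 2 - L2norm (fourier_sum N u) ^+ 2.
Proof.
move=> NM; rewrite -[X in _ = L2norm X ^+ 2 - _](subrKC (fourier_sum N u)).
by rewrite [X in _ = X - _]L2norm_pythagoras ?fourier_sum_orthogonal// addrAC subrr add0r.
Qed.

(** Bessel's inequality for one basis vector. It makes coefficients continuous; using the norm of
    the projection keeps the bound in [R]. *)
Lemma norm_L2dot_le u i : L2norm (L2dot (e i) u *: e i) <= L2norm u.
Proof.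
rewrite -(@ler_pXn2r _ 2)// ?nnegrE ?L2norm_ge0//.
rewrite -[u in leRHS](subrKC (L2dot (e i) u *: e i)).
rewrite L2norm_pythagoras ?lerDl ?sqr_ge0//.
by rewrite L2dotZl L2dotBr L2dotZr e_orthonormal eqxx mulr1 subrr mulr0.
Qed.

Lemma e_norm i : L2norm (e i) = 1.
Proof.
apply/eqP; rewrite -(@eqrXn2 _ 2)// ?L2norm_ge0// expr1n; apply/eqP/complexI.
by rewrite -L2dot_norm e_orthonormal eqxx.
Qed.

Lemma L2dot_eq u v : (forall i, L2dot (e i) u = L2dot (e i) v) -> u = v.
Proof.
move=> uv; apply/eqP; rewrite -subr_eq0; apply/eqP/e_total => i.
by rewrite L2dotBr uv subrr.
Qed.

(** The squared norms of the Fourier sums increase and are bounded by Bessel, so they converge;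
    their increments are the squared distances. *)
Lemma fourier_sum_cauchy u (eps : R) : 0 < eps ->
  exists N, forall m n, (N <= m)%N -> (N <= n)%N ->
    L2norm (fourier_sum m u - fourier_sum n u) <= eps.
Proof.
move=> e0; pose a n := L2norm (fourier_sum n u) ^+ 2.
have nda : nondecreasing_seq a.
  by move=> n m nm; rewrite -subr_ge0 -fourier_sum_sub// sqr_ge0.
have : cvgn a.
  apply: nondecreasing_is_cvgn => //; exists (L2norm u ^+ 2) => _ [n _ <-].
  by rewrite /a lerXn2r ?nnegrE ?L2norm_ge0// bessel.
have e20 : 0 < eps ^+ 2 by rewrite exprn_gt0.
move=> acv; have al n : a n <= limn a by exact: nondecreasing_cvgn_le.
move: acv => /cvgrPdist_le/(_ _ e20)[N _ aN]; exists N.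
(* The distance is symmetric, so the ordered case suffices. *)
wlog : / forall m n, (N <= m)%N -> (m <= n)%N ->
    L2norm (fourier_sum n u - fourier_sum m u) <= eps.
  apply=> m n Nm mn; rewrite -(@ler_pXn2r _ 2)// ?nnegrE ?L2norm_ge0 ?(ltW e0)//.
  rewrite fourier_sum_sub//; have /= := aN m Nm.
  by rewrite ger0_norm ?subr_ge0 ?al// => h; apply: le_trans h; rewrite lerD2r al.
move=> H m n Nm Nn; have [mn|/ltnW nm] := leqP m n; last exact: H.
by rewrite L2normB; exact: H.
Qed.

(** Completeness gives a limit [v]; by continuity it has the coefficients of [u], and totality
    identifies the two. *)
Lemma fourier_sum_cvg u : L2cvg (fourier_sum ^~ u) u.
Proof.
have [v Fv] := L2_complete (fourier_sum_cauchy u).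
suff uv : u = v by rewrite {2}uv.
apply: L2dot_eq => i; apply/eqP; rewrite -subr_eq0 -L2dotBr.
suff : L2norm (L2dot (e i) (u - v) *: e i) = 0.
  move=> /L2norm0_eq0/(congr1 (L2dot (e i))).
  by rewrite L2dotZr e_orthonormal eqxx mulr1 L2dot0r => ->.
apply/eqP; rewrite eq_le L2norm_ge0 andbT; apply/ler_addgt0Pr => eps e0.
rewrite add0r; have [N FN] := Fv _ e0.
(* Far enough for the Fourier sum to be close to [v] and to contain the [i]-th term of [u]. *)
pose n := maxn N (choice.pickle i).+1.
rewrite (_ : L2dot _ _ = L2dot (e i) (fourier_sum n u - v)).
  by apply: le_trans (norm_L2dot_le _ _) _; apply: FN; rewrite leq_maxl.
by rewrite !L2dotBr L2dot_fourier_sum leq_maxr mul1r.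
Qed.

(** A diagonal operator is bounded by the supremum of its multipliers: finite Fourier sums are
    compared term by term, then [N] tends to infinity. *)
Lemma L2norm_le_of_coef x y (a : I -> R) (C : R) : 0 <= C ->
  (forall i, `|a i| <= C) ->
  (forall i, L2dot (e i) x = (a i)%:C * L2dot (e i) y) ->
  L2norm x <= C * L2norm y.
Proof.
move=> C0 aC xy; apply: (L2cvg_norm_le (fourier_sum_cvg x)) => N.
apply: (@le_trans _ _ (C * L2norm (fourier_sum N y))); last first.
  by rewrite ler_wpM2l// bessel.
rewrite -(@ler_pXn2r _ 2)// ?nnegrE ?mulr_ge0 ?L2norm_ge0// exprMn.
suff : (L2norm (fourier_sum N x) ^+ 2)%:C <=
    (C ^+ 2)%:C * (L2norm (fourier_sum N y) ^+ 2)%:C by rewrite -realcM lecR.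
rewrite !L2norm_lincomb ?initial_seq_uniq// mulr_sumr.
apply: ler_sum => i _; rewrite xy rmorphM/= mulrACA ler_wpM2r//.
  by rewrite mulrC mul_conjC_ge0.
have -> : ((a i)%:C)^* * (a i)%:C = (a i ^+ 2)%:C.
  by apply/eqP; rewrite eq_complex /=; apply/andP; split; apply/eqP; ring.
by rewrite lecR -[a i ^+ 2]real_normK ?num_real// lerXn2r ?nnegrE.
Qed.

(** Uniformly bounded multipliers that converge pointwise converge strongly: [u] is split into a
    finite Fourier sum, where convergence is uniform, and a remainder of small norm, where the bound
    [C] suffices. *)
Lemma diagonal_cvg u (x : nat -> L2 P) (a : nat -> I -> R) (b : I -> R) (C : R) :
  0 <= C -> (forall n i, 0 <= a n i <= C) ->
  (forall i, a ^~ i @ \oo --> b i) ->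
  (forall n i, L2dot (e i) (x n) = (a n i)%:C * L2dot (e i) u) ->
  exists v, L2cvg x v.
Proof.
move=> C0 aC ab xu; apply: L2_complete => eps e0.
(* The added 1, here and in [eta], guards against [C] or the norm of [u] being 0. *)
have d0 : 0 < eps / 2 / (C + 1) by rewrite !divr_gt0// ltr_wpDl.
have [N /(_ N (leqnn N))] := fourier_sum_cvg u d0.
rewrite L2normB => uN.
have n0 : 0 < eps / 2 / (L2norm u + 1) by rewrite !divr_gt0// ltr_wpDl// L2norm_ge0.
set eta := eps / 2 / (L2norm u + 1) in n0.
have [M aM] : exists M, forall m n i, (M <= m)%N -> (M <= n)%N ->
    i \in initial_seq N -> `|a m i - a n i| <= eta.
  elim: (initial_seq N) => [|i r [M aM]]; first by exists 0%N.
  have /cvgrPdist_le/(_ _ (divr_gt0 n0 (ltr0Sn R 1)))[M' _ bM] := ab i.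
  exists (maxn M M') => m n j; rewrite !geq_max => /andP[Mm Mm'] /andP[Mn Mn'].
  rewrite inE => /predU1P[->|jr]; last exact: aM.
  rewrite -(subrKA (b i)) (le_trans (ler_normD _ _))// [leRHS]splitr lerD//.
    by rewrite distrC; exact: bM.
  exact: bM.
exists M => m n Mm Mn.
(* The part of [x m - x n] carried by the first basis vectors. *)
pose p := \sum_(i <- initial_seq N) ((a m i - a n i)%:C * L2dot (e i) u) *: e i.
have pE i : L2dot (e i) p =
    ((choice.pickle i < N)%:R * (a m i - a n i))%:C * L2dot (e i) u.
  rewrite L2dot_lincomb ?initial_seq_uniq// mem_initial_seq mulrA.
  by rewrite realcM [_%:C in RHS]rmorph_nat.
rewrite -[x m - x n](subrKC p) (le_trans (ler_L2normD _ _))// [leRHS]splitr.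
apply: lerD.
  apply: (@le_trans _ _ (eta * L2norm u)).
    apply: (L2norm_le_of_coef _ _ pE); first exact: ltW.
    move=> i; case: ltnP => iN; last by rewrite mul0r normr0 ltW.
    by rewrite mul1r aM// mem_initial_seq.
  rewrite /eta -mulrA ler_piMr ?(ltW (divr_gt0 e0 _))//.
  rewrite mulrC ler_pdivrMr ?mul1r ?lerDl// ltr_wpDl// L2norm_ge0.
  by [].
apply: (@le_trans _ _ (C * L2norm (u - fourier_sum N u))).
  apply: (@L2norm_le_of_coef _ _ (fun i => a m i - a n i)) => //.
    (* Both multipliers lie in [[0, C]], so their difference is at most [C] in absolute value. *)
    move=> i; have /andP[? ?] := aC m i; have /andP[? ?] := aC n i.
    by rewrite ler_norml; apply/andP; split; lra.
  move=> i; rewrite !L2dotBr pE !xu L2dot_fourier_sum !rmorphM rmorph_nat rmorphB.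
  by ring.
apply: (@le_trans _ _ (C * (eps / 2 / (C + 1)))); first by rewrite ler_wpM2l.
rewrite mulrCA ler_piMr ?(ltW (divr_gt0 e0 _))//.
by rewrite ler_pdivrMr ?mul1r ?lerDl// ltr_wpDl.
Qed.

End orthonormal_basis.

(** * The basis of products of Bernoulli variables *)

Section finite_expectation.
Context d (T : measurableType d) (R : realType) (P : probability T R).
Implicit Types (f g h : T -> R).

(** Integrability is bundled with the value, so that the linear rules carry no side conditions. *)
Definition has_int f (v : R) :=
  P.-integrable setT (EFin \o f) /\ \int[P]_x f x = v.

Lemma has_int_measurable f v : has_int f v -> measurable_fun setT f.
Proof. by case=> /measurable_int/measurable_EFinP. Qed.

Lemma has_intD f g v w : has_int f v -> has_int g w ->
  has_int (fun x => f x + g x) (v + w).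
Proof.
move=> [fi <-] [gi <-]; split; last by rewrite RintegralD.
exact: (integrableD measurableT fi gi).
Qed.

Lemma has_intZ a f v : has_int f v -> has_int (fun x => a * f x) (a * v).
Proof.
move=> [fi <-]; split; last by rewrite RintegralZl.
exact: (integrableZl measurableT a fi).
Qed.

Lemma has_int_ae f g v : measurable_fun setT f -> {ae P, forall x, f x = g x} ->
  has_int g v -> has_int f v.
Proof.
move=> mf fg gv; have mg := has_int_measurable gv; case: gv => gi <-.
split; last exact: ae_eq_Rintegral.
move/integrableP : gi => [_ goo]; apply/integrableP; split.
  exact/measurable_EFinP.
suff -> : (\int[P]_x `|(EFin \o f) x| = \int[P]_x `|(EFin \o g) x|)%E by [].
apply: ae_eq_integral => //.
- by apply: measurableT_comp => //; exact/measurable_EFinP.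
- by apply: measurableT_comp => //; exact/measurable_EFinP.
- by apply: filterS fg => x /= ->.
Qed.

Lemma prod_mem (V : comNzRingType) (r s : seq nat) (F : nat -> V) :
  uniq r -> uniq s -> {subset s <= r} ->
  \prod_(i <- s) F i = \prod_(i <- r) (if i \in s then F i else 1).
Proof.
move=> ur us sr; rewrite -[RHS]big_mkcond -[RHS]big_filter; apply: perm_big.
apply: uniq_perm; rewrite ?filter_uniq// => i; rewrite mem_filter.
by case: (boolP (i \in s)) => // /sr ->.
Qed.

(** Expanding the affine factors yields monomials in the [X i]; their integrals are multiplicative,
    so the expanded sum factors again. This serves both for independence and for orthogonality. *)
Lemma has_int_multiaffine (f : T -> R) (X : nat -> T -> R) (c : R) (m a b : nat -> R) :
  (forall t, uniq t ->
    has_int (fun x => f x * \prod_(i <- t) X i x) (c * \prod_(i <- t) m i)) ->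
  forall s, uniq s ->
    has_int (fun x => f x * \prod_(i <- s) (a i + b i * X i x))
            (c * \prod_(i <- s) (a i + b i * m i)).
Proof.
move=> H s us.
(* The induction on [s] needs [t], the indices whose factor [X i] has already been chosen in the
   expansion. *)
suff K : forall t, uniq (t ++ s) ->
    has_int (fun x => f x * \prod_(i <- t) X i x * \prod_(i <- s) (a i + b i * X i x))
            (c * \prod_(i <- t) m i * \prod_(i <- s) (a i + b i * m i)).
  have := K [::] us; rewrite big_nil mulr1.
  by under [fun x => _]funext do rewrite big_nil mulr1.
elim: s {us} => [|i s IH] t uts.
  rewrite big_nil mulr1; under [fun x => _]funext do rewrite big_nil mulr1.
  by apply: H; rewrite cats0 in uts.
have uits : uniq ((i :: t) ++ s) by rewrite -(perm_uniq (permEl (perm_catCA t [:: i] s))).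
have uts' : uniq (t ++ s) by case/andP : uits.
have := has_intD (has_intZ (a i) (IH t uts')) (has_intZ (b i) (IH (i :: t) uits)).
rewrite !big_cons => E.
rewrite [X in has_int _ X](_ : _ = a i * (c * \prod_(j <- t) m j *
    \prod_(i0 <- s) (a i0 + b i0 * m i0)) + b i * (c * (m i * \prod_(j <- t) m j) *
    \prod_(i0 <- s) (a i0 + b i0 * m i0))); last by ring.
rewrite [X in has_int X _](_ : _ = (fun x => a i * (f x * \prod_(i <- t) X i x *
    \prod_(i <- s) (a i + b i * X i x)) + b i * (f x * \prod_(i <- i :: t) X i x *
    \prod_(i <- s) (a i + b i * X i x)))) //.
by apply/funext => x; rewrite !big_cons; ring.
Qed.

Lemma prod_indic (t : seq nat) (B : nat -> set T) x :
  \prod_(i <- t) \1_(B i) x = \1_(\bigcap_(i in [set` t]) B i) x :> R.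
Proof.
rewrite [RHS]indicE; case: (boolP (x \in _)) => [/set_mem|] xB.
  by rewrite big_seq big1// => i it; rewrite indicE mem_set//; exact: xB.
have [i it xi] : exists2 i, i \in t & ~ B i x.
  apply: contrapT => nB; move/negP : xB; apply; apply/mem_set => i it.
  by apply: contrapT => nBi; apply: nB; exists i.
rewrite (big_rem i)//= indicE [_ \in _](_ : _ = false) ?mul0r//.
by apply/negbTE/negP => /set_mem.
Qed.

End finite_expectation.

(** * Orthonormality and totality of the products *)

Section bernoulli_basis.
Context (R : realType) d (T : measurableType d) (P : probability T R).
Context (p : nat -> R) (Z : nat -> {RV P >-> R}).
Hypothesis p01 : forall n, 0 < p n < 1.
Hypothesis Ztheta : forall n, P (Z n @^-1` [set theta p n]) = (p n)%:E.
Hypothesis ZthetaV : forall n, P (Z n @^-1` [set - (theta p n)^-1]) = (1 - p n)%:E.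
Hypothesis Zindep : independent_RVs Z.

Let th := theta p.
Let th' n := - (th n)^-1.

Lemma theta_gt0 n : 0 < th n.
Proof.
have /andP[p0 p1] := p01 n.
by rewrite /th /theta sqrtr_gt0 divr_gt0// subr_gt0.
Qed.

Lemma theta_sqr n : th n ^+ 2 = (1 - p n) / p n.
Proof.
have /andP[p0 p1] := p01 n.
by rewrite sqr_sqrtr// ltW// divr_gt0// subr_gt0.
Qed.

Lemma theta_neq_thetaV n : th n - th' n != 0.
Proof. by rewrite gt_eqF// /th' opprK addr_gt0 ?invr_gt0 ?theta_gt0. Qed.

(** The mean of [Z n]: as [1 - p n] equals [th n ^+ 2 * p n], the two terms cancel. *)
Lemma theta_mean n : th n * p n + th' n * (1 - p n) = 0.
Proof.
have /andP[p0 p1] := p01 n; have t0 := theta_gt0 n.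
have := theta_sqr n; move: t0; rewrite /th'; set t := th n => t0 E.
have -> : 1 - p n = t ^+ 2 * p n by rewrite E mulfVK// gt_eqF.
by field; rewrite gt_eqF.
Qed.

(** The second moment of [Z n]: the two terms are [1 - p n] and [p n]. *)
Lemma theta_variance n : th n ^+ 2 * p n + th' n ^+ 2 * (1 - p n) = 1.
Proof.
have /andP[p0 p1] := p01 n; have t0 := theta_gt0 n.
have := theta_sqr n; move: t0; rewrite /th'; set t := th n => t0 E.
have qE : 1 - p n = t ^+ 2 * p n by rewrite E mulfVK// gt_eqF.
have -> : t ^+ 2 * p n + (- t^-1) ^+ 2 * (1 - p n) = t ^+ 2 * p n + p n.
  by rewrite qE; field; rewrite gt_eqF.
by rewrite -qE subrK.
Qed.

Lemma measurable_Z n : measurable_fun setT (Z n).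
Proof. exact: measurable_funPT. Qed.

(** The two values are distinct and their probabilities add up to 1. *)
Lemma ae_two_valued : {ae P, forall x, forall n, Z n x = th n \/ Z n x = th' n}.
Proof.
apply: ae_foralln => n.
have mA y : measurable (Z n @^-1` [set y]).
  by rewrite -[X in measurable X]setTI; exact: (measurable_Z n).
have mU : measurable (Z n @^-1` [set th n] `|` Z n @^-1` [set th' n]).
  exact: measurableU.
have PU : P (Z n @^-1` [set th n] `|` Z n @^-1` [set th' n]) = 1%E.
  rewrite measureU//; last first.
    apply/seteqP; split => // x [/= -> E].
    by have := theta_neq_thetaV n; rewrite -E subrr eqxx.
  rewrite [X in (X + _)%E](_ : _ = (p n)%:E); last exact: Ztheta.
  rewrite [X in (_ + X)%E](_ : _ = (1 - p n)%:E); last exact: ZthetaV.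
  by rewrite -EFinD addrC subrK.
exists (~` (Z n @^-1` [set th n] `|` Z n @^-1` [set th' n])); split.
- exact: measurableC.
- by apply: etrans (probability_setC P mU) _; rewrite PU subee.
- by move=> x /= H [Hx|Hx]; apply: H; [left|right].
Qed.

Let A n := Z n @^-1` [set th n].

Let mA n : measurable (A n).
Proof. by rewrite -[X in measurable X]setTI; exact: (measurable_Z n). Qed.

(** Independence enters here, applied to the singletons of the values [th i]. The factors 1 fit the
    form of [has_int_multiaffine]. *)
Lemma has_int_prod_indic t : uniq t ->
  has_int P (fun x => 1 * \prod_(i <- t) \1_(A i) x) (1 * \prod_(i <- t) p i).
Proof.
move=> ut; rewrite mul1r.
pose s := [fset i in t]%fset.
have st : perm_eq s t.
  by apply: uniq_perm; [exact: fset_uniq|by []|move=> i; rewrite !inE].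
have stE : [set` t] = [set` s] by apply/seteqP; split => i /=; rewrite !inE.
rewrite (_ : (fun x => _) = \1_(\bigcap_(i in [set` s]) A i)); last first.
  by apply/funext => x; rewrite mul1r prod_indic stE.
have mcap : measurable (\bigcap_(i in [set` s]) A i).
  by apply: bigcap_measurableType.
split; first exact: integrable_indic.
rewrite /Rintegral; under eq_integral => x _ do rewrite -[_%:E]/((EFin \o \1__) x).
rewrite integral_indic// setIT.
have := @Zindep s (fun i => [set th i]) (fun i => measurable_set1 _) => /= ->.
under eq_bigr => i _ do rewrite Ztheta.
by rewrite prodEFin /= (perm_big _ st).
Qed.

(** Almost surely [g i (Z i x)] is affine in the indicator of [A i], since [Z i] takes two values;
    expectations of products then factor. *)
Lemma has_int_prod (g : nat -> R -> R) t : (forall i, measurable_fun setT (g i)) ->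
  uniq t -> has_int P (fun x => \prod_(i <- t) g i (Z i x))
    (\prod_(i <- t) (g i (th i) * p i + g i (th' i) * (1 - p i))).
Proof.
move=> mg ut.
have := has_int_multiaffine (fun i => g i (th' i))
  (fun i => g i (th i) - g i (th' i)) has_int_prod_indic ut.
rewrite mul1r [X in has_int _ _ X -> _](_ : _ =
  \prod_(i <- t) (g i (th i) * p i + g i (th' i) * (1 - p i))); last first.
  by apply: eq_bigr => i _; ring.
apply: has_int_ae.
  apply: measurable_prod => i _.
  exact: measurableT_comp.
apply: filterS ae_two_valued => x Zx; rewrite mul1r; apply: eq_bigr => i _.
rewrite indicE; case: (Zx i) => [zE|zE].
  by rewrite mem_set//= mulr1 subrKC zE.
rewrite (_ : x \in A i = false) ?mulr0 ?addr0 ?zE//.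
apply/negbTE/negP => /set_mem; rewrite /A /= zE => E.
by have := theta_neq_thetaV i; rewrite -E subrr eqxx.
Qed.

Lemma measurable_Zprod (s : {fset nat}) :
  measurable_fun setT (fun x => \prod_(i <- s) Z i x).
Proof. by apply: measurable_prod => i _; exact: measurable_Z. Qed.

Lemma Zprod_sqint (s : {fset nat}) :
  (fun x => (\prod_(i <- s) Z i x)%:C%C) \in @sqint _ _ R P.
Proof.
apply/andP; split; last first.
  have [cl0 _] := Lfun_addr_closed P (lee1n 2 : (1 <= 2%:E)%E).
  exact: cl0.
apply: Lfun2I; first exact: measurable_Zprod.
have [/integrableP[_ +] _] := has_int_prod (fun=> @exprn_measurable R setT 2) (fset_uniq s).
apply: le_lt_trans; rewrite le_eqVlt; apply/orP; left; apply/eqP.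
by apply: eq_integral => x _ /=; rewrite prodrXl ger0_norm ?sqr_ge0.
Qed.

(** Square integrability rules out the junk value of [L2class]. *)
Lemma Zprod_pi s : Zprod Z s = (\pi_(L2 P) (SqIntFun (Zprod_sqint s)))%qT.
Proof.
rewrite /Zprod /L2class; congr (\pi_(L2 P) _)%qT; apply: val_inj.
by rewrite insubdK//; exact: Zprod_sqint.
Qed.

(** Merged over the union, the product has factor [Z_i^2], [Z_i] or 1 as [i] lies in both sets, in
    exactly one, or in neither. The means are 1, 0 and 1, so one index in the symmetric difference
    makes the integral vanish. *)
Lemma Zprod_orthonormal (s t : {fset nat}) :
  L2dot (Zprod Z s) (Zprod Z t) = (s == t)%:R.
Proof.
rewrite !Zprod_pi L2dot_pi.
pose g i z : R := (if i \in s then z else 1) * (if i \in t then z else 1).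
have mg i : measurable_fun setT (g i).
  by rewrite /g; case: (i \in s); case: (i \in t); exact: measurable_funM.
pose r := undup (s ++ t).
have [_ E] := has_int_prod mg (undup_uniq (s ++ t)); rewrite -/r in E.
have m1 i : g i (th i) * p i + g i (th' i) * (1 - p i) = ((i \in s) == (i \in t))%:R.
  rewrite /g; case: ifP => _; case: ifP => _ /=.
  - by rewrite -!expr2 theta_variance.
  - by rewrite !mulr1 theta_mean.
  - by rewrite !mul1r theta_mean.
  - by rewrite !mul1r subrKC.
apply/eqP; rewrite eq_complex; apply/andP; split; apply/eqP.
  transitivity (\int[P]_x \prod_(i <- r) g i (Z i x)).
    apply: eq_Rintegral => x _; rewrite Re_mulconj /= mulr0 addr0 /g big_split /=.
    congr (_ * _); apply: prod_mem; rewrite ?undup_uniq ?fset_uniq// => i it;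
      by rewrite mem_undup mem_cat it ?orbT.
  rewrite E; under eq_bigr do rewrite m1.
  have [->|st] := eqVneq s t; first by rewrite big1// => i _; rewrite eqxx.
  have [i ir ist] : exists2 i, i \in r & (i \in s) != (i \in t).
    apply: contrapT => nE; move/negP : st; apply; apply/eqP/fsetP => i.
    have [ir|] := boolP (i \in r).
      by apply: contrapT => /eqP ist; apply: nE; exists i.
    by rewrite mem_undup mem_cat negb_or => /andP[/negbTE -> /negbTE ->].
  by rewrite (big_rem i)//= (negbTE ist) mul0r; case: (s == t).
transitivity (\int[P]_x (cst 0 x : R)).
  by apply: eq_Rintegral => x _; rewrite Im_mulconj /= mulr0 mul0r subrr.
by rewrite Rintegral_cst// mul0r; case: eqP.
Qed.

Hypothesis Zgen : generated_by Z.

Lemma ae_eq0_of_orthogonal_Zprod (g : T -> R) :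
  (forall t, uniq t -> has_int P (fun x => g x * \prod_(i <- t) Z i x) 0) ->
  {ae P, forall x, g x = 0}.
Proof.
move=> gZ.
have [gi g0] : has_int P g 0.
  have := gZ [::] isT; rewrite [X in has_int _ X](_ : _ = g)//.
  by apply/funext => x; rewrite big_nil mulr1.
have mg : measurable_fun setT g by move/measurable_int/measurable_EFinP : gi.
(* Cylinders are stable under intersection and generate the sigma-algebra, as Dynkin's theorem
   requires. *)
pose cylinder (C : set T) := exists (s : {fset nat}) (B : nat -> set R),
  (forall i, measurable (B i)) /\ C = \bigcap_(i in [set` s]) (Z i @^-1` B i).
have mC C : cylinder C -> measurable C.
  move=> [s [B [mB ->]]]; apply: bigcap_measurableType => i _.
  by rewrite -[X in measurable X]setTI; exact: measurable_Z.
have cylE : @measurable d T = <<s cylinder >>.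
  rewrite Zgen; apply/seteqP; split; last first.
    rewrite -Zgen; apply: smallest_sub; last exact: mC.
    exact: sigma_algebra_measurable.
  apply: smallest_sub; first exact: smallest_sigma_algebra.
  apply: bigcup_sub => n _ _ [B mB <-]; apply: sub_gen_smallest.
  exists [fset n]%fset, (fun=> B); split => //; rewrite setTI.
  by apply/seteqP; split => [x xB i /=|x xB]; [rewrite inE => /eqP ->|apply: xB; rewrite /= inE].
have RE0 E : measurable E -> \int[P]_(x in E) g x = 0 ->
    (\int[P]_(x in E) (g x)%:E = 0)%E.
  move=> mE E0; rewrite -[LHS]fineK; first exact/congr1.
  by apply: integrable_fin_num => //; exact: integrableS gi.
have gE E : measurable E -> \int[P]_(x in E) g x = 0.
  rewrite cylE; move: E; apply: (dynkin_induction cylE) => //.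
  - move=> _ _ [s1 [B1 [mB1 ->]]] [s2 [B2 [mB2 ->]]].
    (* On the union of the index sets, missing constraints are filled with [setT]. *)
    exists (s1 `|` s2)%fset, (fun i => (if i \in s1 then B1 i else setT) `&`
      (if i \in s2 then B2 i else setT)); split.
      by move=> i; apply: measurableI; case: ifP.
    apply/seteqP; split => [x [xB1 xB2] i /= _|x xB].
      by split; case: ifP => // ?; [exact: xB1|exact: xB2].
    split => i /= is12; have := xB i.
      by rewrite /= inE is12 => /(_ isT)[].
    by rewrite /= inE is12 orbT => /(_ isT)[].
  - move=> C cC; have := mC _ cC; move: cC => [s [B [mB CE]]] mCC.
    rewrite Rintegral_mkcond.
    (* [a i + b i * z] interpolates the indicator of [B i] at the two values of [Z i]. *)
    pose b i := (\1_(B i) (th i) - \1_(B i) (th' i)) / (th i - th' i) : R.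
    pose a i := \1_(B i) (th' i) - b i * th' i : R.
    (* All monomial integrals vanish, which fits the multiplicative form with constants 0. *)
    have H t : uniq t -> has_int P (fun x => g x * \prod_(i <- t) Z i x)
        (0 * \prod_(i <- t) (0 : R)) by move=> ut; rewrite mul0r; exact: gZ.
    have := has_int_multiaffine a b H (fset_uniq s); rewrite mul0r => gab.
    suff [] : has_int P (g \_ C) 0 by [].
    apply: has_int_ae gab.
      by apply/measurable_restrict => //; exact: measurable_funS mg.
    apply: filterS ae_two_valued => x Zx; rewrite patchE.
    have <- : \1_C x = \prod_(i <- s) (a i + b i * Z i x) :> R.
      rewrite CE -prod_indic; apply: eq_bigr => i _.
      rewrite [LHS](_ : _ = \1_(B i) (Z i x)) //.
      by rewrite /a /b; case: (Zx i) => ->; field; exact: theta_neq_thetaV.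
    by rewrite indicE; case: ifP; rewrite ?mulr1 ?mulr0.
  - move=> C mCC C0; have := @Rintegral_setU _ _ _ P _ _ g mCC (measurableC mCC).
    rewrite setUv => /(_ gi); rewrite g0 C0 add0r => <- //.
    by apply/disj_set2P; rewrite setICr.
  - move=> F mF tF F0; rewrite /Rintegral integral_bigcup//.
      by rewrite eseries0// => n _ _; exact: RE0.
    by apply: integrableS gi => //; exact: bigcup_measurable.
have : ae_eq P setT (EFin \o g) (cst 0).
  apply: integral_ae_eq => // E _ mE.
  by rewrite integral0; exact/RE0/gE.
by apply: filterS => x /(_ I) /= [].
Qed.

(** The products are real, so orthogonality of [u] splits into that of its real and imaginary
    parts. *)
Lemma Zprod_total (u : L2 P) : (forall s, L2dot (Zprod Z s) u = 0) -> u = 0.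
Proof.
elim/quotW: u => f fZ.
have [fR fI] : {ae P, forall x, complex.Re (f x) = 0} /\
    {ae P, forall x, complex.Im (f x) = 0}.
  have H t : uniq t ->
      has_int P (fun x => complex.Re (f x) * \prod_(i <- t) Z i x) 0 /\
      has_int P (fun x => complex.Im (f x) * \prod_(i <- t) Z i x) 0.
    move=> ut; pose s := [fset i in t]%fset.
    have st : perm_eq t s.
      by apply: uniq_perm; [by []|exact: fset_uniq|move=> i; rewrite !inE].
    have [F sF FE] : exists2 F : sqintfun P, Zprod Z s = (\pi_(L2 P) F)%qT &
        forall x, F x = (\prod_(i <- t) Z i x)%:C%C.
      exists (SqIntFun (Zprod_sqint s)); first exact: Zprod_pi.
      by move=> x; rewrite (perm_big _ st).
    have [iR iI] := integrable_mulconj F f.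
    have := fZ s; rewrite sF L2dot_pi => /eqP.
    rewrite eq_complex => /andP[/eqP R0 /eqP I0].
    have KR : (fun x => complex.Re (f x) * \prod_(i <- t) Z i x) =
        (fun x => complex.Re (((F x)^*)%C * f x)).
      by apply/funext => x; rewrite Re_mulconj FE /= mul0r addr0 mulrC.
    have KI : (fun x => complex.Im (f x) * \prod_(i <- t) Z i x) =
        (fun x => complex.Im (((F x)^*)%C * f x)).
      by apply/funext => x; rewrite Im_mulconj FE /= mul0r subr0 mulrC.
    by rewrite KR KI; split; split.
  by split; apply: ae_eq0_of_orthogonal_Zprod => t ut; have [] := H t ut.
have pi0 : (\pi_(L2 P) 0)%qT = 0 :> L2 P by exact: raddf0.
rewrite -pi0; apply/L2_eqP; apply: filterS2 fR fI => x.
by rewrite -[(0 : sqintfun P) x]/(0 : R[i]); case: (f x) => ? ? /= -> ->.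
Qed.

End bernoulli_basis.

(** * Diagonalization of the weighted number operator *)

Section weighted_number_operator_spectrum.
Context (R : realType) d (T : measurableType d) (P : probability T R).
Local Open Scope complex_scope.
Local Open Scope fset_scope.
Context (Z : nat -> {RV P >-> R}).
Hypothesis Z_orthonormal : forall s t : {fset nat},
  L2dot (Zprod Z s) (Zprod Z t) = (s == t)%:R.
Hypothesis Z_total :
  forall u : L2 P, (forall s, L2dot (Zprod Z s) u = 0) -> u = 0.
Context (D : nat -> {linear L2 P -> L2 P}) (Ds : nat -> L2 P -> L2 P).
Hypothesis D_annihilation : forall k, is_annihilation Z k (D k).
Hypothesis Ds_adjoint : forall k, is_adjoint (D k) (Ds k).
Implicit Types (u v : L2 P) (s t : {fset nat}) (j k n : nat).

Let e := Zprod Z.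

Lemma annihilation_Zprod k s : D k (e s) = (k \in s)%:R *: e (s `\ k).
Proof. by have [_ ->] := D_annihilation k. Qed.

Lemma L2dot_adjoint k u v : L2dot u (Ds k v) = L2dot (D k u) v.
Proof. by rewrite [LHS]L2dotC Ds_adjoint [RHS]L2dotC. Qed.

(** [Ds k] is given as a mere function; homogeneity comes from adjointness, because coefficients
    determine a vector. *)
Lemma adjointZ k (a : R[i]) u : Ds k (a *: u) = a *: Ds k u.
Proof.
apply: (L2dot_eq Z_total) => s.
by rewrite L2dotZr !L2dot_adjoint L2dotZr.
Qed.

(** In coefficients: [k] lies in [t] and removing it gives [s] exactly when [k] is not in [s] and
    adding it gives [t]. *)
Lemma creation_Zprod k s : Ds k (e s) = (k \notin s)%:R *: e (k |` s).
Proof.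
apply: (L2dot_eq Z_total) => t.
rewrite L2dot_adjoint annihilation_Zprod L2dotZl L2dotZr !Z_orthonormal.
rewrite conjC_nat -!natrM !mulnb; congr ((nat_of_bool _)%:R).
apply/andP/andP => [[kt /eqP <-]|[ks /eqP ->]].
  by rewrite fsetD1K// eqxx !inE eqxx.
by rewrite fsetU1K// eqxx !inE eqxx.
Qed.

(** The eigenvalue of [Ds k \o D j \o Ds j \o D k] at [e s]: [k] must be present to be removed,
    after which [j] must be absent. *)
Definition eigenfactor s j k := (k \in s) && ((j == k) || (j \notin s)).

Lemma annihilation_creation_Zprod s j k :
  Ds k (D j (Ds j (D k (e s)))) = (eigenfactor s j k)%:R *: e s.
Proof.
rewrite annihilation_Zprod !(adjointZ, linearZ) /=.
rewrite /eigenfactor; have [ks|ks] := boolP (k \in s); last by rewrite !scale0r.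
rewrite creation_Zprod !(adjointZ, linearZ) /= scale1r !inE negb_and negbK.
case: ((j == k) || (j \notin s)) / idP => jks; last by rewrite !scale0r.
rewrite annihilation_Zprod !inE eqxx /= !scale1r fsetU1K; last first.
  by rewrite !inE negb_and negbK.
by rewrite creation_Zprod !inE eqxx /= scale1r fsetD1K.
Qed.

(** * Eigenvalues of the square partial sums *)

Context (w : nat -> nat -> R).
Hypothesis w_ge0 : forall j k, 0 <= w j k.
Let S := wnum (fun k => D k) Ds w.
Let DomS := wnum_dom (fun k => D k) Ds w.
Let s_ u := square_sums (wnum_term (fun k => D k) Ds w u).

Definition partial_vartheta n s : R :=
  \sum_(0 <= j < n.+1) \sum_(0 <= k < n.+1) (eigenfactor s j k)%:R * w j k.

(** The composed operator is symmetric: four uses of adjointness move it onto the basis vector, so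
    [u] need not be expanded. *)
Lemma L2dot_wnum_term u s j k :
  L2dot (e s) (wnum_term (fun k => D k) Ds w u j k) =
  ((eigenfactor s j k)%:R * w j k)%:C * L2dot (e s) u.
Proof.
rewrite L2dotZr L2dot_adjoint -Ds_adjoint L2dot_adjoint -Ds_adjoint.
by rewrite annihilation_creation_Zprod L2dotZl conjC_nat realcM [_%:R%:C]rmorph_nat; ring.
Qed.

Lemma L2dot_square_sums u s n :
  L2dot (e s) (s_ u n) = (partial_vartheta n s)%:C * L2dot (e s) u.
Proof.
rewrite L2dot_sumr /partial_vartheta raddf_sum mulr_suml; apply: eq_bigr => j _.
rewrite L2dot_sumr raddf_sum mulr_suml; apply: eq_bigr => k _.
exact: L2dot_wnum_term.
Qed.

Lemma partial_vartheta_ge0 n s : 0 <= partial_vartheta n s.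
Proof. by do 2!apply: sumr_ge0 => ? _; exact: mulr_ge0. Qed.

Lemma partial_vartheta_nondecreasing s : nondecreasing_seq (partial_vartheta ^~ s).
Proof.
apply/nondecreasing_seqP => n; rewrite /partial_vartheta [leRHS]big_nat_recr//=.
rewrite -[leLHS]addr0 lerD//; last by apply: sumr_ge0 => ? _; exact: mulr_ge0.
apply: ler_sum => j _; rewrite [leRHS]big_nat_recr//= -[leLHS]addr0 lerD//.
exact: mulr_ge0.
Qed.

(** As [s] is finite, each inner sum over [k] stops at its maximum [N]. From [N] on, the square sums
    are therefore partial sums of the two series in [vartheta]. *)
Lemma partial_vartheta_cvg_ereal s :
  (fun n => (partial_vartheta n s)%:E) @ \oo --> vartheta w s.
Proof.
pose N := (\max_(i <- s) i)%N.
have sN k : k \in s -> (k <= N)%N by move=> ks; exact: leq_bigmax_seq.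
pose b j k : \bar R := ((1 - (j \in s)%:R) * (k \in s)%:R * w j k)%:E.
have b0 j k : (0 <= b j k)%E.
  by rewrite lee_fin !mulr_ge0//; case: (j \in s); rewrite ?subrr ?subr0.
have bE j n : (N <= n)%N -> (\sum_(0 <= k <oo) b j k = \sum_(0 <= k < n.+1) b j k)%E.
  move=> Nn; apply/lim_near_cst => //; exists n.+1 => // m /= nm.
  rewrite (@big_cat_nat _ _ _ n.+1)//= [X in (_ + X)%E = _](_ : _ = 0%E) ?adde0//.
  rewrite big_nat big1// => k /andP[nk _]; rewrite /b (_ : k \in s = false).
    by rewrite mulr0 mul0r.
  by apply/negbTE/negP => /sN; rewrite leqNgt (leq_ltn_trans Nn nk).
pose a j : \bar R := ((j \in s)%:R * w j j)%:E.
have a0 j : (0 <= a j)%E by rewrite lee_fin mulr_ge0.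
have B0 j : (0 <= \sum_(0 <= k <oo) b j k)%E by exact: nneseries_ge0.
have ptE n : (N <= n)%N -> (partial_vartheta n s)%:E =
    (\sum_(0 <= j < n.+1) a j + \sum_(0 <= j < n.+1) \sum_(0 <= k <oo) b j k)%E.
  move=> Nn; rewrite -big_split/= -sumEFin !big_nat; apply: eq_bigr => j jn.
  (* On the diagonal [b j j] vanishes and [a j] is the whole term; off the diagonal only [b]
     contributes. *)
  rewrite (bE _ _ Nn) (bigD1_seq j) ?mem_index_iota ?iota_uniq//=.
  rewrite [in RHS](bigD1_seq j) ?mem_index_iota ?iota_uniq//=.
  rewrite EFinD addeA; congr (_ + _)%E.
    rewrite -EFinD /eigenfactor eqxx andbT; congr EFin.
    by case: (j \in s); rewrite /= ?subrr; ring.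
  rewrite -sumEFin; apply: eq_bigr => k /negbTE kj.
  rewrite /b /eigenfactor eq_sym kj orFb; congr EFin.
  by case: (j \in s); case: (k \in s); rewrite /= ?subrr; ring.
have : (fun n => \sum_(0 <= j < n) a j + \sum_(0 <= j < n) \sum_(0 <= k <oo) b j k)%E
    @ \oo --> vartheta w s.
  apply: cvgeD.
  - by apply: ge0_adde_def; rewrite inE; apply: nneseries_ge0 => *; [exact: a0|exact: B0].
  - exact: is_cvg_nneseries.
  - exact: is_cvg_nneseries.
(* Square sums include the index [n], so they match the series stopped before [n.+1]. *)
rewrite -cvg_shiftS; apply: cvg_trans; apply: near_eq_cvg.
by exists N => // n /= /ptE ->.
Qed.

(** * Finite eigenvalues and boundedness *)

Hypothesis w_sup : (ereal_sup (range (fun k : nat =>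
  \sum_(0 <= j <oo) (w j k)%:E)) < +oo)%E.

Lemma vartheta_ge0 s : (0 <= vartheta w s)%E.
Proof.
rewrite -(cvg_lim _ (@partial_vartheta_cvg_ereal s))//.
apply: lime_ge; first by apply: cvgP; exact: partial_vartheta_cvg_ereal.
by apply: nearW => n; rewrite lee_fin partial_vartheta_ge0.
Qed.

(** The sums of [w j k] over [j] have a common bound [M], and only the indices [k] in [s]
    contribute: the total is at most [M] times the size of [s]. *)
Lemma vartheta_fin_num s : vartheta w s \is a fin_num.
Proof.
rewrite ge0_fin_numE ?vartheta_ge0//.
have [M wM] : exists M : R, forall k n, \sum_(0 <= j < n) w j k <= M.
  have Woo := w_sup; set W := ereal_sup _ in Woo.
  have W0 : (0 <= W)%E.
    apply: (@le_trans _ _ (\sum_(0 <= j <oo) (w j 0%N)%:E)%E).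
      by apply: nneseries_ge0 => j _ _; rewrite lee_fin.
    by apply: ereal_sup_ubound; exists 0%N.
  exists (fine W) => k n; rewrite -lee_fin fineK ?ge0_fin_numE// -sumEFin.
  apply: (@le_trans _ _ (\sum_(0 <= j <oo) (w j k)%:E)%E).
    by apply: nneseries_lim_ge => j _ _; rewrite lee_fin.
  by apply: ereal_sup_ubound; exists k.
have M0 : 0 <= M by have := wM 0%N 0%N; rewrite big_geq.
apply: (@le_lt_trans _ _ (M * (size s)%:R)%:E); last exact: ltry.
rewrite -(cvg_lim _ (@partial_vartheta_cvg_ereal s))//.
apply: lime_le; first by apply: cvgP; exact: partial_vartheta_cvg_ereal.
apply: nearW => n; rewrite lee_fin /partial_vartheta exchange_big_nat/=.
apply: (@le_trans _ _ (\sum_(0 <= k < n.+1 | k \in s) M)).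
  rewrite [leRHS]big_mkcond; apply: ler_sum => k _.
  case: ifPn => ks; last by rewrite big1// => j _; rewrite /eigenfactor (negbTE ks) mul0r.
  apply: le_trans (wM k n.+1); apply: ler_sum => j _.
  by rewrite ler_piMl//; case: eigenfactor.
rewrite -big_filter big_const_seq count_predT iter_addr_0 -[leLHS]mulr_natr ler_wpM2l// ler_nat.
apply: uniq_leq_size; first by rewrite filter_uniq ?iota_uniq.
by move=> k; rewrite mem_filter => /andP[].
Qed.

Let theta_ s : R := fine (vartheta w s).

Lemma partial_vartheta_cvg s : partial_vartheta ^~ s @ \oo --> theta_ s.
Proof.
apply: (@fine_cvg _ _ _ _ (fun n => (partial_vartheta n s)%:E));
rewrite fineK ?vartheta_fin_num//.
exact: partial_vartheta_cvg_ereal.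
Qed.

Lemma partial_vartheta_le n s : partial_vartheta n s <= theta_ s.
Proof.
rewrite -(cvg_lim _ (@partial_vartheta_cvg s))//.
apply: nondecreasing_cvgn_le; first exact: partial_vartheta_nondecreasing.
by apply: cvgP; exact: partial_vartheta_cvg.
Qed.

Lemma L2norm_realZ (r : R) u : L2norm (r%:C *: u) = `|r| * L2norm u.
Proof. by apply: complexI; rewrite L2normZ realcM normc_def /= expr0n addr0 sqrtr_sqr. Qed.

Lemma wnumP u v : L2cvg (s_ u) v -> DomS u /\ S u = v.
Proof.
move=> /cvgn_L2P suv; split; first exact: cvgP suv.
by apply: cvg_lim suv; exact: norm_hausdorff.
Qed.

Lemma wnum_Zprod s : DomS (e s) /\ S (e s) = (theta_ s)%:C *: e s.
Proof.
apply: wnumP => eps e0.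
have /cvgrPdist_le/(_ _ e0)[N _ NP] := @partial_vartheta_cvg s.
exists N => n Nn.
have -> : s_ (e s) n = (partial_vartheta n s)%:C *: e s.
  apply: (L2dot_eq Z_total) => t; rewrite L2dot_square_sums L2dotZr Z_orthonormal.
  by case: eqVneq => [->//|_]; rewrite !mulr0.
rewrite -scalerBl -rmorphB L2norm_realZ (e_norm Z_orthonormal) mulr1 distrC.
exact: NP.
Qed.

(** [e s] is a unit eigenvector and its eigenvalue is nonnegative. *)
Lemma vartheta_eq_norm s : vartheta w s = (L2norm (S (e s)))%:E.
Proof.
have [_ ->] := wnum_Zprod s.
rewrite L2norm_realZ (e_norm Z_orthonormal) mulr1 ger0_norm ?fine_ge0 ?vartheta_ge0//.
by rewrite fineK ?vartheta_fin_num.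
Qed.

(** All partial eigenvalues lie in [[0, C]], so the square sums converge for every [u], and their
    common norm bound passes to the limit. *)
Lemma wnum_bounded (C : R) : (forall s, (vartheta w s <= C%:E)%E) ->
  forall u, DomS u /\ L2norm (S u) <= C * L2norm u.
Proof.
move=> thC u.
have C0 : 0 <= C by rewrite -lee_fin (le_trans _ (thC fset0))// vartheta_ge0.
have pC n s : 0 <= partial_vartheta n s <= C.
  rewrite partial_vartheta_ge0/= (le_trans (partial_vartheta_le _ _))//.
  by rewrite -lee_fin fineK ?vartheta_fin_num.
have [v suv] := diagonal_cvg Z_orthonormal Z_total C0 pC partial_vartheta_cvg
  (fun n s => L2dot_square_sums u s n).
have [Du ->] := wnumP suv; split=> //.
apply: (L2cvg_norm_le suv) => n.
apply: (L2norm_le_of_coef Z_orthonormal Z_total C0 _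
  (fun s => L2dot_square_sums u s n)) => s.
by have /andP[p0 ?] := pC n s; rewrite ger0_norm.
Qed.

End weighted_number_operator_spectrum.

(** * Boundedness criterion, norm and domain *)

Theorem theorem4p3 (R : realType) (d : measure_display) (T : measurableType d)
    (P : probability T R) (p : nat -> R) (Z : nat -> {RV P >-> R})
    (p01 : forall n, 0 < p n < 1)
    (Ztheta : forall n, P (Z n @^-1` [set theta p n]) = (p n)%:E)
    (ZthetaV : forall n, P (Z n @^-1` [set - (theta p n)^-1]) = (1 - p n)%:E)
    (Zindep : independent_RVs Z)
    (Zgen : generated_by Z)
    (D : nat -> {linear L2 P -> L2 P}) (Ds : nat -> L2 P -> L2 P)
    (D_annihilation : forall k, is_annihilation Z k (D k))
    (Ds_adjoint : forall k, is_adjoint (D k) (Ds k))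
    (w : nat -> nat -> R)
    (w_ge0 : forall j k, 0 <= w j k)
    (w_sup : (ereal_sup (range (fun k : nat =>
                \sum_(0 <= j <oo) (w j k)%:E)) < +oo)%E) :
  let S := wnum (fun k => D k) Ds w in
  let DomS := wnum_dom (fun k => D k) Ds w in
  let sup_vartheta := ereal_sup (range (vartheta w)) in
  (bounded_on DomS S <-> (sup_vartheta < +oo)%E) /\
  (bounded_on DomS S ->
     opnorm DomS S = sup_vartheta /\ DomS = [set: L2 P]).
Proof.
move=> S DomS sup_vartheta.
have on := Zprod_orthonormal p01 Ztheta ZthetaV Zindep.
have total := Zprod_total p01 Ztheta ZthetaV Zindep Zgen.
have thE := vartheta_eq_norm on total D_annihilation Ds_adjoint w_ge0 w_sup.
have DomZ s : DomS (Zprod Z s).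
  by have [] := wnum_Zprod on total D_annihilation Ds_adjoint w_ge0 w_sup s.
have sup_finite : (sup_vartheta < +oo)%E ->
    exists2 C : R, sup_vartheta = C%:E &
      forall u, DomS u /\ L2norm (S u) <= C * L2norm u.
  move=> supoo.
  have th_sup s : (vartheta w s <= sup_vartheta)%E by apply: ereal_sup_ubound; exists s.
  (* The value at the empty set keeps the supremum away from minus infinity. *)
  have supfin : sup_vartheta \is a fin_num.
    by rewrite ge0_fin_numE// (le_trans _ (th_sup fset0))// vartheta_ge0.
  exists (fine sup_vartheta); first by rewrite fineK.
  apply: (wnum_bounded on total D_annihilation Ds_adjoint w_ge0 w_sup) => s.
  by rewrite fineK.
(* Any operator bound dominates every eigenvalue, since the eigenvectors are unit vectors in the
   domain. *)
have bounded_sup : bounded_on DomS S -> (sup_vartheta < +oo)%E.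
  move=> [M SM]; apply: (@le_lt_trans _ _ M%:E); last exact: ltry.
  apply: ge_ereal_sup => _ [s _ <-]; rewrite thE lee_fin.
  by apply: le_trans (SM _ (DomZ s)) _; rewrite (e_norm on) mulr1.
split; first split=> //.
  by move=> /sup_finite[C _ SC]; exists C => u _; have [] := SC u.
move=> /bounded_sup/sup_finite[C supE SC]; split; last first.
  by apply/seteqP; split=> // u _; have [] := SC u.
have C0 : 0 <= C.
  rewrite -lee_fin -supE; apply: le_trans (vartheta_ge0 w_ge0 fset0) _.
  by apply: ereal_sup_ubound; exists fset0.
(* The bound [C] on the unit ball gives one inequality, the unit eigenvectors the other. *)
apply/eqP; rewrite eq_le; apply/andP; split.
  rewrite supE; apply: ge_ereal_sup => _ [u [_ /= u1] <-]; rewrite lee_fin.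
  by have [_ /le_trans] := SC u; apply; rewrite ler_piMr.
apply: ge_ereal_sup => _ [s _ <-]; rewrite thE; apply: ereal_sup_ubound.
by exists (Zprod Z s) => //; split=> //=; rewrite (e_norm on).
Qed.
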